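(* There is a Borel-measurable map $\mathrm{Tensor}:\Gamma\times\Gamma\to\Gamma$ such that $$C^*(\mathrm{Tensor}(\gamma,\delta))\cong C^*(\gamma)\otimes_{\min}C^*(\delta)$$ for all $\gamma,\delta\in\Gamma$. Moreover, there is a Borel-measurable map $\mathrm{Tensor}_0:\Gamma\times\Gamma\to\Gamma$ such that if $1\in C^*(\delta)$ then $C^*(\mathrm{Tensor}_0(\gamma,\delta))$ is the canonical copy of $C^*(\gamma)$ inside $C^*(\gamma)\otimes_{\min}C^*(\delta)$; that is, there is a $*$-isomorphism of $C^*(\gamma)\otimes_{\min}C^*(\delta)$ onto $C^*(\mathrm{Tensor}(\gamma,\delta))$ carrying $C^*(\gamma)\otimes 1$ onto $C^*(\mathrm{Tensor}_0(\gamma,\delta))$.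
   Context: Let $H$ be a separable infinite-dimensional complex Hilbert space, $\mathcal B(H)$ with the Borel structure generated by the weakly open sets, $\Gamma=\mathcal B(H)^{\mathbb N}$ with the product Borel structure, and for $\gamma\in\Gamma$ let $C^*(\gamma)\subseteq\mathcal B(H)$ be the C$^*$-algebra generated by the terms of $\gamma$. Here $1$ denotes the identity operator on $H$, and $\otimes_{\min}$ is the minimal (spatial) C$^*$-tensor product. *)

(* Defs.v *)
From HB Require Import structures.
From mathcomp Require Import all_boot all_order all_algebra.
From mathcomp Require Import complex.
From mathcomp Require Import all_classical all_reals all_analysis.

Set Implicit Arguments.
Unset Strict Implicit.
Unset Printing Implicit Defensive.

Import Order.TTheory GRing.Theory Num.Theory.
Import numFieldNormedType.Exports.

Local Open Scope classical_set_scope.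
Local Open Scope ring_scope.
Local Open Scope complex_scope.

(* The inner product is linear in its first argument and conjugate-linear in
   the second one. *)
HB.mixin Record CompleteNormedModule_isHilbert (R : realType) (H : Type)
    of CompleteNormedModule (R[i] : numFieldType) H := {
  inner : H -> H -> R[i] ;
  inner_linear : forall (a : R[i]) (x y z : H),
    inner (a *: x + y) z = a * inner x z + inner y z ;
  inner_conj : forall x y : H, inner x y = Num.conj (inner y x) ;
  inner_norm : forall x : H, inner x x = `|x| ^+ 2
}.

#[short(type="hilbertType")]
HB.structure Definition Hilbert (R : realType) :=
  { H of CompleteNormedModule_isHilbert R H &
         CompleteNormedModule (R[i] : numFieldType) H }.

Section InnerProduct.
Variables (R : realType) (H : hilbertType R).

Let C : numClosedFieldType := R[i].

Lemma inner_bilinear : bilinear_for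
  (GRing.Scale.Law.clone _ _ *%R _) (GRing.Scale.Law.clone _ _ (@Num.conj C \; *%R) _)
  (@inner R H : H -> H -> C).
Proof.
split=> u a x y /=; first exact: inner_linear.
by rewrite inner_conj inner_linear rmorphD rmorphM /= [inner u x]inner_conj
  [inner u y]inner_conj.
Qed.

HB.instance Definition _ := @bilinear_isBilinear.Build C H H C _ _
  (@inner R H : H -> H -> C) inner_bilinear.

Lemma inner_hermitian (x y : H) :
  (inner x y : C) = (-1) ^+ false * Num.conj (inner y x : C).
Proof. by rewrite expr0 mul1r; exact: inner_conj. Qed.

HB.instance Definition _ := @isHermitianSesquilinear.Build C H false
  (@Num.conj C) (@inner R H : H -> H -> C) inner_hermitian.

Lemma inner_gt0 (x : H) : x != 0 -> 0 < (inner x x : C).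
Proof. by move=> x0; rewrite inner_norm exprn_gt0// normr_gt0. Qed.

HB.instance Definition _ := @isDotProduct.Build C H
  (@inner R H : H -> H -> C) inner_gt0.

End InnerProduct.

Definition separable (T : topologicalType) : Prop :=
  exists2 D : set T, countable D & dense D.

Definition infinite_dimensional (R : realType) (H : hilbertType R) : Prop :=
  ~ exists (n : nat) (v : 'I_n -> H),
      forall x : H, exists c : 'I_n -> R[i], x = \sum_(i < n) c i *: v i.

Section BoundedOperators.
Variables (R : realType) (H : hilbertType R).

(* For linear maps between normed spaces, continuous is the same as bounded. *)
Definition bounded_operator : {pred (H -> H)} :=
  fun f => `[< linear f /\ continuous f >].

Lemma bounded_operator_submod : submod_closed bounded_operator.
Proof.
split; first by apply/asboolP; split;
  [by move=> a x y; rewrite scaler0 addr0|exact: cst_continuous].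
move=> a f g /asboolP[fl fc] /asboolP[gl gc]; apply/asboolP; split.
- move=> b x y; rewrite /= !fctE fl gl !scalerDr !scalerA [a * b]mulrC -!addrA.
  by congr +%R; rewrite addrCA.
- by move=> x; apply: cvgD; [apply: cvgZr; exact: fc|exact: gc].
Qed.

HB.instance Definition _ :=
  GRing.isSubmodClosed.Build R[i] (H -> H) bounded_operator
    bounded_operator_submod.

Record bop : Type := Bop {
  bop_fun :> H -> H ;
  bopP : bop_fun \in bounded_operator
}.

HB.instance Definition _ := [isSub for bop_fun].
HB.instance Definition _ := [Choice of bop by <:].
HB.instance Definition _ := [SubChoice_isSubLmodule of bop by <:].
HB.instance Definition _ := isPointed.Build bop 0.

Lemma id_bounded_operator : (id : H -> H) \in bounded_operator.
Proof. by apply/asboolP; split => // x; exact: cvg_id. Qed.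

Definition bop_id : bop := Bop id_bounded_operator.

Lemma comp_bounded_operator (S T : bop) :
  (S : H -> H) \o (T : H -> H) \in bounded_operator.
Proof.
have /asboolP[Sl Sc] := bopP S; have /asboolP[Tl Tc] := bopP T.
apply/asboolP; split; first by move=> a x y; rewrite /= Tl Sl.
by move=> x; apply: continuous_comp; [exact: Tc|exact: Sc].
Qed.

Definition bop_comp (S T : bop) : bop := Bop (comp_bounded_operator S T).

(* Adjoints are handled relationally: [is_adjoint T S] says that S = T^*. *)
Definition is_adjoint (T S : bop) : Prop :=
  forall x y : H, inner (T x) y = inner x (S y).

Definition opnorm (T : bop) : R :=
  sup [set complex.Re `|T x| | x in [set x : H | `|x| <= 1]].

Definition norm_closure (A : set bop) : set bop :=
  [set T | forall e : R, 0 < e -> exists2 S, A S & opnorm (T - S) < e].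

Definition lin_span (A : set bop) : set bop :=
  [set T | exists (n : nat) (c : 'I_n -> R[i]) (S : 'I_n -> bop),
     (forall i, A (S i)) /\ T = \sum_(i < n) c i *: S i].

(* C*-subalgebras of B(H), not necessarily unital. *)
Definition cstar_subalgebra (A : set bop) : Prop :=
  [/\ [/\ A 0,
          (forall S T, A S -> A T -> A (S + T)) &
          (forall (c : R[i]) T, A T -> A (c *: T))],
      (forall S T, A S -> A T -> A (bop_comp S T)),
      (forall S T, A T -> is_adjoint T S -> A S) &
      norm_closure A `<=` A].

Definition wot_eval (T : bop) : H * H -> R[i]^o := fun p => inner (T p.1) p.2.

(* The weak operator topology is the coarsest one for which the maps
   T |-> <T x, y> are continuous. *)
Definition wot : topologicalType :=
  @initial_topology bop (prod_topology (fun _ : H * H => R[i]^o)) wot_eval.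

Definition borel_bop : Type := g_sigma_algebraType (@open wot).

Definition Gamma_cylinders : set (set (nat -> bop)) :=
  [set A | exists (n : nat) (B : set borel_bop),
     measurable B /\ A = (fun g : nat -> bop => g n) @^-1` B].

(* The product Borel structure on sequences of operators. *)
Definition Gamma : Type := g_sigma_algebraType Gamma_cylinders.

Definition Cstar (g : Gamma) : set bop := smallest cstar_subalgebra (range g).

End BoundedOperators.

Section TensorProducts.
Variables (R : realType) (H K : hilbertType R).

(* (K, t) is the Hilbert space tensor product of H with itself: t is bilinear,
   multiplicative on inner products, and simple tensors have dense span.  This
   determines (K, t) up to a unique unitary isomorphism. *)
Definition hilbert_tensor (t : {bilinear H -> H -> K}) : Prop :=
  (forall x y x' y' : H,
     inner (t x y) (t x' y') = inner x x' * inner y y') /\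
  dense [set z : K | exists (n : nat) (x y : 'I_n -> H),
                       z = \sum_(i < n) t (x i) (y i)].

Variable t : {bilinear H -> H -> K}.

(* T is the operator S1 (x) S2. *)
Definition is_tensor_op (S1 S2 : bop H) (T : bop K) : Prop :=
  forall x y : H, T (t x y) = t (S1 x) (S2 y).

(* The spatial tensor product: the norm closure, in B(H (x) H), of the linear
   span of the operators S1 (x) S2 with S1 in A and S2 in B. *)
Definition min_tensor (A B : set (bop H)) : set (bop K) :=
  norm_closure (lin_span
    [set T | exists S1 S2, [/\ A S1, B S2 & is_tensor_op S1 S2 T]]).

Definition tensor_one (A : set (bop H)) : set (bop K) :=
  [set T | exists2 S, A S & is_tensor_op S (bop_id H) T].

End TensorProducts.

(* f, restricted to A, is a *-isomorphism of A onto B; its values outside A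
   are irrelevant. *)
Definition star_isomorphism (R : realType) (H K : hilbertType R)
    (A : set (bop H)) (B : set (bop K)) (f : bop H -> bop K) : Prop :=
  [/\ set_bij A B f,
      (forall (c : R[i]) S T, A S -> A T -> f (c *: S + T) = c *: f S + f T),
      (forall S T, A S -> A T -> f (bop_comp S T) = bop_comp (f S) (f T)) &
      (forall S T, A S -> A T -> is_adjoint S T -> is_adjoint (f S) (f T))].

Definition star_isomorphic (R : realType) (H K : hilbertType R)
    (A : set (bop H)) (B : set (bop K)) : Prop :=
  exists f : bop H -> bop K, star_isomorphism A B f.

(* Main.v *)
(* Let (e_i) be an orthonormal basis of H.  Then (e_i (x) e_j) is an orthonormal
   basis of H (x) H, so there is a unitary u : H (x) H -> H.  Words in the terms
   of g and their adjoints span a dense subspace of C*(g), and likewise for d;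
   approximating first in one variable and then in the other shows that
   C*(g) (x)min C*(d) is generated by the countably many operators w (x) w' with
   w a nonempty word in g and w' a nonempty word in d.  Take for Tensor(g, d) the
   enumeration of the operators u (w (x) w') u^*, and for Tensor0(g, d) the
   sequence u (g_n (x) 1) u^*.
   The matrix coefficients of compositions, adjoints and tensor products are
   pointwise limits of polynomials in the coefficients of the factors and their
   conjugates.  Coefficients suffice to test measurability: on each norm ball the
   weak operator topology is given by countably many of them, and the norm balls
   are themselves cut out by countably many conditions on coefficients. *)
Require Import Defs.
From HB Require Import structures.
From mathcomp Require Import all_boot all_order all_algebra.
From mathcomp Require Import complex.
From mathcomp Require Import all_classical all_reals all_analysis.
From mathcomp Require Import measurable_realfun ring lra.

Set Implicit Arguments.
Unset Strict Implicit.
Unset Printing Implicit Defensive.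

Import Order.TTheory GRing.Theory Num.Theory.
Import numFieldNormedType.Exports.
Import ComplexField.Normc.

Local Open Scope classical_set_scope.
Local Open Scope ring_scope.

(** * Inner products *)

(** Two obstacles shape the proof. The weak operator topology on B(H) is not second countable, so an
    open set need not be a countable union of basic ones, and composition is only separately
    continuous for it. Measurability is therefore handled through [wmeas], measurability of every
    matrix coefficient, which all the operations involved preserve; it is compared with the Borel
    structure only at the two ends. The norm bound on a ball is what lets coefficients on a
    countable dense set control all the others. On the algebraic side, the generated algebras need
    not contain 1: words must be nonempty, and S (x) 1 is reached not as a limit of tensor words but
    by applying the amplification homomorphism to the generators. Both homomorphisms in use,
    amplification and conjugation by the unitary, have contractive left inverses, which makes images
    of C*-algebras closed without spectral theory. The unitary is fixed before g and d, so one
    conjugation is the isomorphism for all pairs and carries the copy of C*(g) as well. *)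

Lemma cvg_dist_le (R : realType) (a b : nat -> R) (l : R) :
  (forall n, `|a n - l| <= b n) -> b @ \oo --> (0 : R) -> a @ \oo --> l.
Proof.
move=> ab /cvgrPdist_lt b0; apply/cvgrPdist_lt => e e0.
near=> n; rewrite distrC (le_lt_trans (ab n))//.
rewrite (le_lt_trans (ler_norm _))//.
have -> : `|b n| = `|0 - b n| by rewrite sub0r normrN.
by near: n; exact: b0.
Unshelve. all: by end_near. Qed.

Section InnerProductBasics.
Variables (R : realType) (H : hilbertType R).
Implicit Types (x y z : H) (a : R[i]).

(** The norm of a module over R[i] is a complex number. It is real and nonnegative, so its real part
    carries everything ([rnormE]), and estimates can be made in R, where the order is total. *)
Definition rnorm x : R := complex.Re `|x|.

Lemma rnormE x : `|x| = (rnorm x)%:C%C.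
Proof. by rewrite /rnorm RRe_real// normr_real. Qed.

Lemma rnorm_ge0 x : 0 <= rnorm x.
Proof. by rewrite -lecR -rnormE normr_ge0. Qed.

Lemma rnorm0 : rnorm 0 = 0. Proof. by rewrite /rnorm normr0. Qed.

Lemma rnorm0_eq0 x : rnorm x = 0 -> x = 0.
Proof. by move=> x0; apply/normr0_eq0; rewrite rnormE x0. Qed.

Lemma rnormD x y : rnorm (x + y) <= rnorm x + rnorm y.
Proof. by rewrite -lecR raddfD/= -!rnormE ler_normD. Qed.

Lemma rnormN x : rnorm (- x) = rnorm x.
Proof. by rewrite /rnorm normrN. Qed.

Lemma rnormB x y : rnorm (x - y) = rnorm (y - x).
Proof. by rewrite -opprB rnormN. Qed.

Lemma normcE_norm a : `|a| = (normc a)%:C%C.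
Proof. by rewrite normc_def; case: a. Qed.

Lemma normc_ge0 a : 0 <= normc a.
Proof. by rewrite -lecR -normcE_norm normr_ge0. Qed.

Lemma rnormZ a x : rnorm (a *: x) = normc a * rnorm x.
Proof. by apply: complexI; rewrite rmorphM/= -!rnormE -normcE_norm normrZ. Qed.

Lemma innerDl x y z : inner (x + y) z = inner x z + inner y z.
Proof. by rewrite -[x in LHS]scale1r inner_linear mul1r. Qed.

Lemma inner0l z : inner 0 z = 0.
Proof. by apply: (addrI (inner 0 z)); rewrite -innerDl !addr0. Qed.

Lemma innerZl a x z : inner (a *: x) z = a * inner x z.
Proof. by rewrite -[a *: x]addr0 inner_linear inner0l addr0. Qed.

Lemma innerNl x z : inner (- x) z = - inner x z.
Proof. by rewrite -scaleN1r innerZl mulN1r. Qed.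

Lemma innerBl x y z : inner (x - y) z = inner x z - inner y z.
Proof. by rewrite innerDl innerNl. Qed.

Lemma innerC x y : inner x y = conjc (inner y x).
Proof. exact: inner_conj. Qed.

Lemma innerDr x y z : inner z (x + y) = inner z x + inner z y.
Proof. by rewrite innerC innerDl rmorphD /= -!innerC. Qed.

Lemma inner0r z : inner z 0 = 0.
Proof. by rewrite innerC inner0l rmorph0. Qed.

Lemma innerZr a x z : inner z (a *: x) = conjc a * inner z x.
Proof. by rewrite innerC innerZl rmorphM /= -!innerC. Qed.

Lemma innerNr x z : inner z (- x) = - inner z x.
Proof. by rewrite innerC innerNl rmorphN /= -innerC. Qed.

Lemma innerBr x y z : inner z (x - y) = inner z x - inner z y.
Proof. by rewrite innerDr innerNr. Qed.

Lemma inner_suml I (r : seq I) (P : pred I) (F : I -> H) z :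
  inner (\sum_(i <- r | P i) F i) z = \sum_(i <- r | P i) inner (F i) z.
Proof.
elim/big_rec2: _ => [|i a x _ <-]; first exact: inner0l.
by rewrite innerDl.
Qed.

Lemma inner_sumr I (r : seq I) (P : pred I) (F : I -> H) z :
  inner z (\sum_(i <- r | P i) F i) = \sum_(i <- r | P i) inner z (F i).
Proof.
elim/big_rec2: _ => [|i a x _ <-]; first exact: inner0r.
by rewrite innerDr.
Qed.

Lemma inner_self x : inner x x = (rnorm x ^+ 2)%:C%C.
Proof. by rewrite inner_norm rnormE rmorphXn. Qed.

Lemma inner_eq0 x : (forall y, inner x y = 0) -> x = 0.
Proof.
move=> /(_ x); rewrite inner_self => /complexI /eqP.
by rewrite sqrf_eq0 => /eqP /rnorm0_eq0.
Qed.

Lemma inner_inj x y : (forall z, inner x z = inner y z) -> x = y.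
Proof.
move=> xy; apply/eqP; rewrite -subr_eq0; apply/eqP/inner_eq0 => z.
by rewrite innerBl xy subrr.
Qed.

Lemma rnorm_sqrD x y :
  rnorm (x + y) ^+ 2 = rnorm x ^+ 2 + rnorm y ^+ 2 + 2 * complex.Re (inner x y).
Proof.
have E u : rnorm u ^+ 2 = complex.Re (inner u u) by rewrite inner_self.
have yx : complex.Re (inner y x) = complex.Re (inner x y).
  by rewrite innerC; case: inner.
by rewrite !E innerDl !innerDr !raddfD /= yx; ring.
Qed.

Lemma rnorm_sqrD_orth x y :
  inner x y = 0 -> rnorm (x + y) ^+ 2 = rnorm x ^+ 2 + rnorm y ^+ 2.
Proof. by move=> xy; rewrite rnorm_sqrD xy mulr0 addr0. Qed.

Lemma normc_sqr a : a * conjc a = (normc a ^+ 2)%:C%C.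
Proof. by rewrite -sqr_normc normcE_norm rmorphXn. Qed.

Lemma conjc_sqr a : conjc a * a = (normc a ^+ 2)%:C%C.
Proof. by rewrite mulrC normc_sqr. Qed.

Lemma normcJ_eq a : normc (conjc a) = normc a.
Proof. by apply: complexI; rewrite -!normcE_norm normcJ. Qed.

Lemma normc_real (r : R) : 0 <= r -> normc r%:C%C = r.
Proof. by move=> r0; apply: complexI; rewrite -normcE_norm ger0_norm// ler0c. Qed.

(** By Pythagoras the projection [c *: y] of [x] onto the line of [y] is no longer than [x], and its
    length is |<x, y>| / |y|. *)
Lemma CauchySchwarz_inner x y : normc (inner x y) <= rnorm x * rnorm y.
Proof.
have [y0|y0] := eqVneq (rnorm y) 0.
  by rewrite (rnorm0_eq0 y0) inner0r normc0 rnorm0 mulr0.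
have ygt0 : 0 < rnorm y by rewrite lt_def y0 rnorm_ge0.
pose c := inner x y * ((rnorm y ^+ 2)^-1)%:C%C.
have o : inner (x - c *: y) (c *: y) = 0.
  rewrite innerZr innerBl innerZl inner_self /c -mulrA -rmorphM /=.
  by rewrite mulVf ?expf_neq0// rmorph1 mulr1 subrr mulr0.
have := rnorm_sqrD_orth o; rewrite subrK rnormZ => h.
have : (normc c * rnorm y) ^+ 2 <= rnorm x ^+ 2 by rewrite h lerDr sqr_ge0.
rewrite ler_pXn2r ?nnegrE ?mulr_ge0 ?normc_ge0 ?rnorm_ge0//.
rewrite /c normcM normc_real ?invr_ge0 ?sqr_ge0// expr2 invfM mulrA divfK//.
by rewrite ler_pdivrMr.
Qed.

Lemma Re_le_normc a : `|complex.Re a| <= normc a.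
Proof. by rewrite -lecR -normcE_norm normc_ge_Re. Qed.

Lemma rnorm_dual x M : 0 <= M ->
  (forall y, normc (inner x y) <= M * rnorm y) -> rnorm x <= M.
Proof.
move=> M0 /(_ x); rewrite inner_self normc_real ?sqr_ge0// expr2.
have [->//|x0] := eqVneq (rnorm x) 0.
by rewrite ler_pM2r// lt_def x0 rnorm_ge0.
Qed.

Definition hlim (u : nat -> H) (l : H) : Prop :=
  (fun n => rnorm (u n - l)) @ \oo --> (0 : R).

Lemma hlimP (u : nat -> H) l : hlim u l <->
  forall e : R, 0 < e -> exists N, forall n, (N <= n)%N -> rnorm (u n - l) < e.
Proof.
split=> [/cvgrPdist_lt ul e e0|ul].
  have [N _ uN] := ul e e0; exists N => n Nn.
  by have := uN n Nn; rewrite /= sub0r normrN ger0_norm ?rnorm_ge0.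
apply/cvgrPdist_lt => e e0; have [N uN] := ul e e0.
by exists N => // n Nn /=; rewrite sub0r normrN ger0_norm ?rnorm_ge0// uN.
Qed.

Lemma hlim_cvg (u : nat -> H) l : hlim u l <-> u @ \oo --> l.
Proof.
rewrite hlimP; split=> [ul|/cvgrPdist_lt ul e e0].
  apply/cvgrPdist_lt => e e0.
  have er : e = (complex.Re e)%:C%C by rewrite RRe_real// gtr0_real.
  have [|N uN] := ul (complex.Re e); first by rewrite -ltcR -er.
  by exists N => // n /uN; rewrite -ltcR -er -rnormE distrC.
have [|N _ uN] := ul e%:C%C; first by rewrite ltcR.
by exists N => n /uN /=; rewrite distrC rnormE ltcR.
Qed.

Lemma hcauchy_lim (u : nat -> H) :
  (forall e : R, 0 < e -> exists N, forall m n, (N <= m)%N -> (m <= n)%N ->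
     rnorm (u n - u m) < e) ->
  exists l, hlim u l.
Proof.
move=> cu; suff /cauchy_cvg/cvg_ex [l ul] : cauchy (u @ \oo).
  by exists l; apply/hlim_cvg.
apply/cauchyP => e e0.
have er : e = (complex.Re e)%:C%C by rewrite RRe_real// gtr0_real.
have [|N uN] := cu (complex.Re e); first by rewrite -ltcR -er.
exists (u N); exists N => // n Nn; rewrite /= -ball_normE/=.
by rewrite distrC rnormE er ltcR uN.
Qed.

Lemma hlim_unique (u : nat -> H) l l' : hlim u l -> hlim u l' -> l = l'.
Proof. by move=> /hlim_cvg ul /hlim_cvg ul'; apply: cvg_unique ul'. Qed.

Lemma hlim_inner (u : nat -> H) l z : hlim u l ->
  (fun n => normc (inner (u n) z - inner l z)) @ \oo --> (0 : R).
Proof.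
move=> ul; apply: (@squeeze_cvgr _ _ _ _ (fun=> 0) (fun n => rnorm (u n - l) * rnorm z)).
- by near=> n; rewrite normc_ge0/= -innerBl CauchySchwarz_inner.
- exact: cvg_cst.
- by rewrite -[X in _ --> X](mul0r (rnorm z)); apply: cvgMl.
Unshelve. all: by end_near. Qed.

Lemma cvg_normc0 (c : nat -> R[i]) (d : R[i]) :
  (fun n => normc (c n - d)) @ \oo --> (0 : R) ->
  (fun n => complex.Re (c n)) @ \oo --> complex.Re d.
Proof.
by apply: cvg_dist_le => n; rewrite -raddfB Re_le_normc.
Qed.

Lemma hlim_inner_eq (u : nat -> H) l z (c : R[i]) : hlim u l ->
  (\forall n \near \oo, inner (u n) z = c) -> inner l z = c.
Proof.
move=> /(@hlim_inner _ _ z) ul uc; apply/esym/eqP; rewrite -subr_eq0; apply/eqP/eq0_normc.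
apply: (cvg_unique _ _ ul) => //.
apply: cvg_near_cst; near=> n; congr (normc (_ - _)).
by near: n.
Unshelve. all: by end_near. Qed.

End InnerProductBasics.

(** * Bounded maps and orthogonal series *)

Section LinearMaps.
Variables (R : realType) (H K : hilbertType R) (f : H -> K).
Hypothesis lf : linear f.

Let g : {linear H -> K} := HB.pack f (GRing.isLinear.Build _ _ _ _ f lf).

Lemma lin0 : f 0 = 0. Proof. exact: (linear0 g). Qed.

Lemma linZ a x : f (a *: x) = a *: f x. Proof. exact: (linearZ_LR g). Qed.

Lemma linD x y : f (x + y) = f x + f y. Proof. exact: (linearD g). Qed.

Lemma linB x y : f (x - y) = f x - f y. Proof. exact: (linearB g). Qed.

Lemma lin_sum I (r : seq I) (P : pred I) (F : I -> H) :
  f (\sum_(i <- r | P i) F i) = \sum_(i <- r | P i) f (F i).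
Proof. exact: (linear_sum g). Qed.

End LinearMaps.

Section BoundedLinear.
Variable R : realType.
Implicit Types H K L : hilbertType R.

(** The type [bop] only covers operators from a space to itself, while slices and unitaries go
    between [H] and [K]. The explicit constant keeps track of contractions. *)
Definition lbnd H K (f : H -> K) (M : R) : Prop :=
  [/\ linear f, 0 <= M & forall x, rnorm (f x) <= M * rnorm x].

Lemma lbnd_hlim H K (f : H -> K) M (u : nat -> H) l :
  lbnd f M -> hlim u l -> hlim (f \o u) (f l).
Proof.
move=> [lf M0 fM] ul; rewrite /hlim.
apply: (@cvg_dist_le _ _ (fun n => M * rnorm (u n - l))) => [n|].
  by rewrite subr0 ger0_norm ?rnorm_ge0// -linB.
by rewrite -(mulr0 M); apply: cvgMr.
Qed.

Lemma lbnd_continuous H K (f : H -> K) M : lbnd f M -> continuous f.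
Proof.
move=> [lf M0 fM] x; apply/cvgrPdist_lt => e e0.
have er : e = (complex.Re e)%:C%C by rewrite RRe_real// gtr0_real.
have d0 : 0 < complex.Re e / (M + 1).
  by rewrite divr_gt0 ?ltr_pwDr// -ltcR -er.
near=> y; rewrite -linB// rnormE er ltcR (le_lt_trans (fM _))//.
have : rnorm (x - y) < complex.Re e / (M + 1).
  rewrite -ltcR -rnormE; near: y; apply: cvgr_dist_lt => //.
  by rewrite ltcR.
rewrite ltr_pdivlMr ?ltr_pwDr//; apply: le_lt_trans.
by rewrite mulrC ler_wpM2l ?rnorm_ge0// lerDl.
Unshelve. all: by end_near. Qed.

Lemma continuous_lbnd H K (f : H -> K) : linear f -> continuous f ->
  exists M, lbnd f M.
Proof.
move=> lf cf.
pose g : {linear H -> K} := HB.pack f (GRing.isLinear.Build _ _ _ _ f lf).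
have /linear_boundedP/pinfty_ex_gt0 [M M0 gM] :
  bounded_near g (nbhs (0 : H)) by apply/linear_bounded_continuous.
have Mr : M = (complex.Re M)%:C%C by rewrite RRe_real// gtr0_real.
exists (complex.Re M); split => //; first by rewrite -lecR -Mr ltW.
by move=> x; rewrite -lecR rmorphM/= -!rnormE -Mr; exact: gM.
Qed.

Lemma lbnd_comp H K L (f : K -> L) (g : H -> K) M N :
  lbnd f M -> lbnd g N -> lbnd (f \o g) (M * N).
Proof.
move=> [lf M0 fM] [lg N0 gN]; split; first by move=> a x y; rewrite /= lg lf.
  exact: mulr_ge0.
by move=> x /=; rewrite (le_trans (fM _))// -mulrA ler_wpM2l.
Qed.

Lemma bop_linear H (T : bop H) : linear T.
Proof. by case/asboolP: (bopP T). Qed.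

Lemma bop_bound H (T : bop H) : exists M, lbnd T M.
Proof. by case/asboolP: (bopP T) => *; exact: continuous_lbnd. Qed.

Lemma bop_ext H (S T : bop H) : (forall x, S x = T x) -> S = T.
Proof. by move=> ST; apply: val_inj; apply/funext. Qed.

Definition mkbop H (f : H -> H) : bop H := insubd (0 : bop H) f.

Lemma mkbopE H (f : H -> H) M : lbnd f M -> mkbop f = f :> (H -> H).
Proof.
move=> fM; rewrite /mkbop -[LHS]/(val _) insubdK//.
by apply/asboolP; split; [case: fM|exact: lbnd_continuous fM].
Qed.

Lemma bopDE H (S T : bop H) x : (S + T) x = S x + T x. Proof. by []. Qed.
Lemma bopZE H c (T : bop H) x : (c *: T) x = c *: T x. Proof. by []. Qed.
Lemma bop0E H x : (0 : bop H) x = 0. Proof. by []. Qed.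
Lemma bopNE H (T : bop H) x : (- T) x = - T x. Proof. by []. Qed.
Lemma bopBE H (S T : bop H) x : (S - T) x = S x - T x. Proof. by []. Qed.

Lemma opnorm_ge0 H (T : bop H) : 0 <= opnorm T.
Proof.
have [M [_ M0 TM]] := bop_bound T.
rewrite /opnorm; apply: (@le_trans _ _ (complex.Re `|T 0|)).
  exact: (rnorm_ge0 (T 0)).
apply: ub_le_sup; last by exists 0 => //=; rewrite normr0.
exists M => _ [x /= x1 <-]; rewrite (le_trans (TM _))//.
by move: x1; rewrite rnormE (lecR _ 1) => x1; rewrite -[leRHS]mulr1 ler_wpM2l.
Qed.

Lemma opnormP H (T : bop H) x : rnorm (T x) <= opnorm T * rnorm x.
Proof.
have [M [_ M0 TM]] := bop_bound T.
have [x0|x0] := eqVneq (rnorm x) 0.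
  by rewrite (rnorm0_eq0 x0) (lin0 (bop_linear T)) !rnorm0 mulr0.
have xgt0 : 0 < rnorm x by rewrite lt_def x0 rnorm_ge0.
rewrite -ler_pdivrMr//.
have -> : rnorm (T x) / rnorm x = rnorm (T ((rnorm x)^-1%:C%C *: x)).
  by rewrite (linZ (bop_linear T)) rnormZ normc_real ?invr_ge0 ?rnorm_ge0// mulrC.
apply: ub_le_sup; last first.
  exists ((rnorm x)^-1%:C%C *: x) => //=.
  by rewrite rnormE rnormZ normc_real ?invr_ge0 ?rnorm_ge0// mulVf.
exists M => _ [y /= y1 <-]; rewrite (le_trans (TM _))//.
by move: y1; rewrite rnormE (lecR _ 1) => y1; rewrite -[leRHS]mulr1 ler_wpM2l.
Qed.

Lemma opnorm_le H (T : bop H) M : 0 <= M ->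
  (forall x, rnorm (T x) <= M * rnorm x) -> opnorm T <= M.
Proof.
move=> M0 TM; apply: ge_sup.
  by exists (complex.Re `|T 0|); exists 0 => //=; rewrite normr0.
move=> _ [y /= y1 <-]; rewrite (le_trans (TM _))//.
by move: y1; rewrite rnormE (lecR _ 1) => y1; rewrite -[leRHS]mulr1 ler_wpM2l.
Qed.

Lemma bop_lbnd H (T : bop H) : lbnd T (opnorm T).
Proof. by split; [exact: bop_linear|exact: opnorm_ge0|exact: opnormP]. Qed.

Lemma opnormD H (S T : bop H) : opnorm (S + T) <= opnorm S + opnorm T.
Proof.
apply: opnorm_le; first by rewrite addr_ge0 ?opnorm_ge0.
by move=> x; rewrite bopDE (le_trans (rnormD _ _))// mulrDl lerD// opnormP.
Qed.

Lemma opnormZ H c (T : bop H) : opnorm (c *: T) <= normc c * opnorm T.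
Proof.
apply: opnorm_le; first by rewrite mulr_ge0 ?opnorm_ge0 ?normc_ge0.
by move=> x; rewrite bopZE rnormZ -mulrA ler_wpM2l ?normc_ge0// opnormP.
Qed.

Lemma opnormM H (S T : bop H) : opnorm (bop_comp S T) <= opnorm S * opnorm T.
Proof.
by have [_ ? ?] := lbnd_comp (bop_lbnd S) (bop_lbnd T); apply: opnorm_le.
Qed.

Lemma opnorm0 H : opnorm (0 : bop H) = 0.
Proof.
apply/eqP; rewrite eq_le opnorm_ge0 andbT; apply: opnorm_le => // x.
by rewrite bop0E rnorm0 mul0r.
Qed.

Lemma opnormN H (T : bop H) : opnorm (- T) <= opnorm T.
Proof.
by apply: opnorm_le; [exact: opnorm_ge0|move=> x; rewrite bopNE rnormN opnormP].
Qed.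

End BoundedLinear.

Section OrthogonalSeries.
Variable R : realType.
Implicit Types H K : hilbertType R.

Lemma rnorm_sqr_sum K (v : nat -> K) (A : seq nat) : uniq A ->
  (forall i j, i != j -> inner (v i) (v j) = 0) ->
  rnorm (\sum_(i <- A) v i) ^+ 2 = \sum_(i <- A) rnorm (v i) ^+ 2.
Proof.
move=> + vo; elim: A => [_|i A IH /= /andP[iA uA]].
  by rewrite !big_nil rnorm0 expr0n.
rewrite !big_cons rnorm_sqrD_orth ?IH// inner_sumr big_seq big1// => j jA.
by rewrite vo//; apply: contraNneq iA => ->.
Qed.

(** By Pythagoras the squared norm of a block of the series is a difference of partial sums of a
    bounded nondecreasing real series, so the partial sums are Cauchy. *)
Lemma orth_series_cvg K (v : nat -> K) (B : R) : 0 <= B ->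
  (forall i j, i != j -> inner (v i) (v j) = 0) ->
  (forall n, \sum_(0 <= i < n) rnorm (v i) ^+ 2 <= B ^+ 2) ->
  exists l, hlim (fun n => \sum_(0 <= i < n) v i) l /\ rnorm l <= B.
Proof.
move=> B0 vo vB.
pose s n := \sum_(0 <= i < n) rnorm (v i) ^+ 2.
have ds m n : (m <= n)%N ->
    rnorm (\sum_(0 <= i < n) v i - \sum_(0 <= i < m) v i) ^+ 2 = s n - s m.
  move=> mn; rewrite /s (big_cat_nat (leq0n _) mn)/= [in RHS](big_cat_nat (leq0n _) mn)/=.
  rewrite addrAC subrr add0r addrAC subrr add0r.
  by rewrite rnorm_sqr_sum// iota_uniq.
have ns : nondecreasing_seq s.
  by move=> m n mn; rewrite -subr_ge0 -ds// sqr_ge0.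
have cs : cvgn s.
  apply: nondecreasing_is_cvgn; first exact: ns.
  by exists (B ^+ 2) => _ [n _ <-]; exact: vB.
have [l ul] : exists l, hlim (fun n => \sum_(0 <= i < n) v i) l.
  apply: hcauchy_lim => e e0.
  have /cvgrPdist_lt/(_ (e ^+ 2)) := cs; rewrite exprn_gt0// => /(_ isT)[N _ sN].
  exists N => m n Nm mn.
  rewrite -(ltr_pXn2r (ltn0Sn 1)) ?nnegrE ?rnorm_ge0 ?ltW// ds//.
  have := sN m Nm; rewrite /= ger0_norm ?subr_ge0; last exact: nondecreasing_cvgn_le.
  by apply: le_lt_trans; rewrite lerB//; exact: nondecreasing_cvgn_le.
exists l; split=> //; apply/ler_addgt0Pr => e e0.
have /hlimP/(_ e e0)[N uN] := ul.
have := uN N (leqnn N); set S := \sum_(_ <= _ < _) _ => Sl.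
rewrite -[l](subKr S) (le_trans (rnormD _ _))// rnormN lerD//; last exact: ltW.
rewrite -(ler_pXn2r (ltn0Sn 1)) ?nnegrE ?rnorm_ge0//.
by rewrite /S rnorm_sqr_sum// iota_uniq.
Qed.

(** The common source of adjoints, of the unitary and of S (x) 1: each is a sum of maps with
    pairwise orthogonal values and uniformly bounded square sums. *)
Lemma orth_series_map H K (F : nat -> H -> K) (M : R) : 0 <= M ->
  (forall i, linear (F i)) ->
  (forall i j x, i != j -> inner (F i x) (F j x) = 0) ->
  (forall n x, \sum_(0 <= i < n) rnorm (F i x) ^+ 2 <= (M * rnorm x) ^+ 2) ->
  exists2 G : H -> K, lbnd G M &
    forall x, hlim (fun n => \sum_(0 <= i < n) F i x) (G x).
Proof.
move=> M0 lF oF bF.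
have /choice [G GP] : forall x, exists l,
    hlim (fun n => \sum_(0 <= i < n) F i x) l /\ rnorm l <= M * rnorm x.
  move=> x; apply: orth_series_cvg => [|i j|n]; first by rewrite mulr_ge0 ?rnorm_ge0.
    exact: oF.
  exact: bF.
have GS x := (GP x).1.
exists G => //; split => // [a x y|x]; last by have [] := GP x.
apply: (hlim_unique (GS _)); apply/hlim_cvg.
have -> : (fun n => \sum_(0 <= i < n) F i (a *: x + y)) =
    (fun n => a *: \sum_(0 <= i < n) F i x + \sum_(0 <= i < n) F i y).
  apply/funext => n; rewrite scaler_sumr -big_split/=.
  by apply: eq_bigr => i _; rewrite lF.
by apply: cvgD; [apply: cvgZr|]; apply/hlim_cvg; exact: GS.
Qed.

(** The sum [y] of the [p i] satisfies <x, y> = |y|^2, so Cauchy-Schwarz gives |y| <= |x|. The [p i]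
    are arbitrary orthogonal components of [x], since for tensors they are projections onto
    infinite-dimensional ranges. *)
Lemma bessel_gen K (x : K) (p : nat -> K) n :
  (forall i j, i != j -> inner (p i) (p j) = 0) ->
  (forall i, inner x (p i) = (rnorm (p i) ^+ 2)%:C%C) ->
  \sum_(0 <= i < n) rnorm (p i) ^+ 2 <= rnorm x ^+ 2.
Proof.
move=> po px; have := @rnorm_sqr_sum _ _ (index_iota 0 n) (iota_uniq _ _) po.
set y := \sum_(i <- _) p i => yE; rewrite -yE.
have := CauchySchwarz_inner x y.
have -> : inner x y = (rnorm y ^+ 2)%:C%C.
  by rewrite inner_sumr yE rmorph_sum/=; apply: eq_bigr => i _; rewrite px.
rewrite normc_real ?sqr_ge0// => h.
rewrite ler_pXn2r ?nnegrE ?rnorm_ge0//.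
have [->|y0] := eqVneq (rnorm y) 0; first exact: rnorm_ge0.
by move: h; rewrite expr2 ler_pM2r// lt_def y0 rnorm_ge0.
Qed.

End OrthogonalSeries.

Section OrthonormalBases.
Variable R : realType.
Implicit Types H K : hilbertType R.

Definition orthonormal_seq H (e : nat -> H) : Prop :=
  forall i j, inner (e i) (e j) = (i == j)%:R.

Definition hilbert_basis H (e : nat -> H) : Prop :=
  orthonormal_seq e /\ forall x, (forall i, inner x (e i) = 0) -> x = 0.

Lemma orthonormal_rnorm H (e : nat -> H) i : orthonormal_seq e -> rnorm (e i) = 1.
Proof.
move=> eo; have := eo i i; rewrite inner_self eqxx => /complexI/eqP.
by rewrite sqrf_eq1 => /orP[/eqP//|/eqP e1]; have := rnorm_ge0 (e i); rewrite e1 ler0N1.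
Qed.

Lemma orthonormal_orthZ H (e : nat -> H) (c : nat -> R[i]) i j :
  orthonormal_seq e -> i != j -> inner (c i *: e i) (c j *: e j) = 0.
Proof. by move=> eo /negPf ij; rewrite innerZl innerZr eo ij !mulr0. Qed.

Lemma orthonormal_series_coef H (e : nat -> H) (c : nat -> R[i]) l i :
  orthonormal_seq e -> hlim (fun n => \sum_(0 <= k < n) c k *: e k) l ->
  inner l (e i) = c i.
Proof.
move=> eo cl; apply: (hlim_inner_eq cl).
near=> n; have ni : (i < n)%N by near: n; exists i.+1.
rewrite inner_suml (bigD1_seq i) ?mem_index_iota ?iota_uniq//=.
rewrite innerZl eo eqxx mulr1 big1 ?addr0// => j /negPf ji.
by rewrite innerZl eo ji mulr0.
Unshelve. all: by end_near. Qed.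

Lemma bessel H (e : nat -> H) x n : orthonormal_seq e ->
  \sum_(0 <= i < n) normc (inner x (e i)) ^+ 2 <= rnorm x ^+ 2.
Proof.
move=> eo.
have nE i : normc (inner x (e i)) = rnorm (inner x (e i) *: e i).
  by rewrite rnormZ orthonormal_rnorm// mulr1.
under eq_bigr do rewrite nE.
apply: bessel_gen => [i j|i].
  exact: (@orthonormal_orthZ _ _ (fun k => inner x (e k))).
by rewrite -nE innerZr conjc_sqr.
Qed.

(** Bessel makes the series converge; its sum has the same coefficients as [x], and a vector with
    all coefficients zero vanishes. *)
Lemma fourier_expansion H (e : nat -> H) x : hilbert_basis e ->
  hlim (fun n => \sum_(0 <= i < n) inner x (e i) *: e i) x.
Proof.
move=> [eo et].
have [||y [ye _]] := @orth_series_cvg _ _ (fun i => inner x (e i) *: e i) (rnorm x) (rnorm_ge0 _).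
- by move=> i j; exact: (@orthonormal_orthZ _ _ (fun k => inner x (e k))).
- move=> n; under eq_bigr do rewrite rnormZ orthonormal_rnorm// mulr1.
  exact: bessel.
suff xy : x = y by rewrite [X in hlim _ X]xy.
apply/esym/eqP; rewrite -subr_eq0; apply/eqP/et => i; rewrite innerBl.
apply/eqP; rewrite subr_eq0; apply/eqP.
exact: (@orthonormal_series_coef _ _ (fun k => inner x (e k))).
Qed.

(** The partial sums of the Fourier expansion satisfy [P], hence so does their limit. This induction
    principle stands in for the usual arguments by density and continuity. *)
Lemma basis_ind H (e : nat -> H) (P : H -> Prop) : hilbert_basis e ->
  P 0 -> (forall a x y, P x -> P y -> P (a *: x + y)) ->
  (forall u l, (forall n, P (u n)) -> hlim u l -> P l) ->
  (forall i, P (e i)) -> forall x, P x.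
Proof.
move=> eb P0 PD Pl Pe x; apply: Pl (fourier_expansion x eb) => n.
elim: n => [|n IH]; first by rewrite big_geq.
by rewrite big_nat_recr//= addrC; exact: PD.
Qed.

End OrthonormalBases.

(** * Gram-Schmidt bases and adjoints *)

Section Density.
Variables (R : realType) (H : hilbertType R).

Lemma dense_approx (D : set H) x (e : R) : dense D -> 0 < e ->
  exists2 y, D y & rnorm (x - y) < e.
Proof.
move=> dD e0.
have eC : 0 < e%:C%C :> R[i] by rewrite ltcR.
have [|y [xy Dy]] := dD (ball x e%:C%C) _ (ball_open x _).
  by exists x; apply: ballxx.
exists y => //; move: xy; rewrite -ball_normE/= rnormE.
by rewrite ltcR.
Qed.

(** For [y] in [D], |x|^2 = <x, x - y> <= |x| |x - y|, and |x - y| is arbitrarily small. *)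
Lemma approx_orth (D : set H) x :
  (forall e : R, 0 < e -> exists2 y, D y & rnorm (x - y) < e) ->
  (forall y, D y -> inner x y = 0) -> x = 0.
Proof.
move=> dD xD; apply: rnorm0_eq0; apply/eqP; rewrite eq_le rnorm_ge0 andbT.
apply/ler_addgt0Pr => e e0; rewrite add0r; have [y Dy xy] := dD e e0.
have := CauchySchwarz_inner x (x - y).
rewrite innerBr (xD y)// subr0 inner_self normc_real ?sqr_ge0// expr2.
have [->|x0] := eqVneq (rnorm x) 0; first by move=> _; exact: ltW.
by rewrite ler_pM2l ?lt_def ?x0 ?rnorm_ge0// => /le_trans; apply; exact: ltW.
Qed.

Lemma dense_orth (D : set H) x : dense D -> (forall y, D y -> inner x y = 0) -> x = 0.
Proof. by move=> dD; apply: approx_orth => e; exact: dense_approx. Qed.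

Definition dense_seq (d : nat -> H) : Prop :=
  forall x (e : R), 0 < e -> exists n, rnorm (x - d n) < e.

Lemma separable_seq : separable H -> exists d, dense_seq d.
Proof.
move=> [D /countable_injP[f fi] dD].
(* [f] numbers the points of [D] injectively; a number without a point gets 0, which does no harm to
   density. *)
exists (fun n => xget 0 [set x | D x /\ f x = n]) => x e e0.
have [y Dy xy] := dense_approx x dD e0; exists (f y).
case: xgetP => [z _ [Dz fz]|/(_ y)/=]; last by move=> /not_andP[].
by rewrite (fi z y) ?inE.
Qed.

End Density.

Section GramSchmidt.
Variables (R : realType) (H : hilbertType R) (d : nat -> H).

Definition residual (E : seq H) x : H := x - \sum_(v <- E) inner x v *: v.

(** Vectors already in the span are skipped, so position in the list and position in [d] differ.
    Since successive lists extend each other, the basis can be read off position by position. *)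
Fixpoint gram_schmidt n : seq H :=
  if n is m.+1 then
    let E := gram_schmidt m in
    let v := residual E (d m) in
    if v == 0 then E else rcons E ((rnorm v)^-1%:C%C *: v)
  else [::].

Definition orthonormal_list (E : seq H) : Prop :=
  forall i j, (i < size E)%N -> (j < size E)%N ->
    inner (nth 0 E i) (nth 0 E j) = (i == j)%:R.

Lemma residual_orth E x v : orthonormal_list E -> v \in E -> inner (residual E x) v = 0.
Proof.
move=> oE /(nthP 0)[i iE <-]; rewrite innerBl inner_suml (big_nth 0).
rewrite (bigD1_seq i) ?mem_index_iota ?iota_uniq//= innerZl oE// eqxx mulr1.
rewrite big_nat_cond big1 ?addr0 ?subrr// => j /andP[/andP[_ jE] /negPf ji].
by rewrite innerZl oE// ji mulr0.
Qed.

Lemma gram_schmidt_orthonormal n : orthonormal_list (gram_schmidt n).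
Proof.
elim: n => [//|n IH /=]; case: ifPn => // v0.
set v := residual _ _ in v0 *; set E := gram_schmidt n in IH v v0 *.
have vn0 : rnorm v != 0 by apply: contra_neq v0 => /rnorm0_eq0.
have vE i : (i < size E)%N -> inner v (nth 0 E i) = 0.
  by move=> iE; apply: residual_orth => //; exact: mem_nth.
have Ev i : (i < size E)%N -> inner (nth 0 E i) v = 0.
  by move=> iE; rewrite innerC vE// rmorph0.
move=> i j; rewrite !size_rcons !ltnS !nth_rcons.
rewrite leq_eqVlt => /predU1P[->|iE]; rewrite leq_eqVlt => /predU1P[->|jE].
- rewrite ltnn !eqxx innerZl innerZr inner_self conjc_real -!rmorphM/=.
  by rewrite expr2 mulKf// mulVf.
- by rewrite ltnn eqxx jE innerZl vE// mulr0 gtn_eqF.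
- by rewrite ltnn eqxx iE innerZr Ev// mulr0 ltn_eqF.
- by rewrite iE jE IH.
Qed.

Lemma gram_schmidt_prefix m n : (m <= n)%N -> prefix (gram_schmidt m) (gram_schmidt n).
Proof.
move=> /subnK <-; elim: (n - m)%N => [|k IH]; first exact: prefix_refl.
rewrite addSn /=; case: ifP => // _; apply: prefix_trans IH _.
exact: prefix_rcons.
Qed.

Lemma gram_schmidt_nth m n k : (k < size (gram_schmidt m))%N ->
  (k < size (gram_schmidt n))%N -> nth 0 (gram_schmidt m) k = nth 0 (gram_schmidt n) k.
Proof.
wlog mn : m n / (m <= n)%N.
  by move=> h; have [|/ltnW nm] := leqP m n; [exact: h|move=> ? ?; rewrite (h n m)].
have /prefixP[s ->] := gram_schmidt_prefix mn.
by move=> km _; rewrite nth_cat km.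
Qed.

(** That [d n] lies in the span of the list is recorded in its dual form, which is what totality of
    the basis requires. *)
Lemma gram_schmidt_span n x :
  (forall v, v \in gram_schmidt n.+1 -> inner x v = 0) -> inner x (d n) = 0.
Proof.
rewrite /=; set E := gram_schmidt n; set v := residual E (d n) => xE.
have sE y : y \in E -> inner x y = 0.
  by move=> yE; apply: xE; case: ifP => // _; rewrite mem_rcons inE yE orbT.
have -> : d n = v + \sum_(y <- E) inner (d n) y *: y by rewrite /v /residual subrK.
rewrite innerDr inner_sumr big_seq big1 ?addr0; last first.
  by move=> y yE; rewrite innerZr sE// mulr0.
move: xE; case: eqVneq => [->|v0 xE]; first by rewrite inner0r.
have vn0 : rnorm v != 0 by apply: contra_neq v0 => /rnorm0_eq0.
have /(_ ((rnorm v)^-1%:C%C *: v)) := xE.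
rewrite mem_rcons inE eqxx => /(_ isT); rewrite innerZr => /eqP.
rewrite mulf_eq0 conjc_real => /orP[/eqP/complexI/eqP|/eqP//].
by rewrite invr_eq0 (negPf vn0).
Qed.

Hypothesis Hinf : infinite_dimensional H.
Hypothesis dt : forall x, (forall n, inner x (d n) = 0) -> x = 0.

(** If the sizes stopped growing, one list [E] would contain all later vectors. The residual of any
    [x] along [E] would then be orthogonal to every [d n], hence zero, and [E] would span [H]. *)
Lemma gram_schmidt_size k : exists n, (k <= size (gram_schmidt n))%N.
Proof.
elim: k => [|k [n kn]]; first by exists 0%N.
apply: contrapT => /forallNP hk; apply: Hinf.
have bk m : (size (gram_schmidt m) <= k)%N by rewrite leqNgt; apply/negP/hk.
set E := gram_schmidt n in kn.
have mE m v : v \in gram_schmidt m -> v \in E.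
  have [mn|/ltnW nm] := leqP m n.
    by have /prefixP[s E'] := gram_schmidt_prefix mn; rewrite /E E' mem_cat => ->.
  have /prefixP[s E'] := gram_schmidt_prefix nm; move: (bk m); rewrite E' size_cat.
  case: s {E'} => [|w s]; first by rewrite cats0.
  by rewrite addnS => /(leq_ltn_trans (leq_addr _ _)); rewrite ltnNge kn.
exists (size E), (fun i => nth 0 E i) => x; exists (fun i => inner x (nth 0 E i)).
have : residual E x = 0.
  apply: dt => m; apply: gram_schmidt_span => v /mE; apply: residual_orth.
  exact: gram_schmidt_orthonormal.
by move=> /eqP; rewrite subr_eq0 => /eqP {1}->; rewrite (big_nth 0) big_mkord.
Qed.

Lemma gram_schmidt_basis : exists e : nat -> H, hilbert_basis e.
Proof.
have [N NP] := choice gram_schmidt_size.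
(* A list with at least [k.+1] entries has an entry in position [k], and by [gram_schmidt_nth] every
   such list has the same one. *)
pose e k := nth 0 (gram_schmidt (N k.+1)) k.
have eE n k : (k < size (gram_schmidt n))%N -> nth 0 (gram_schmidt n) k = e k.
  by move=> kn; apply: gram_schmidt_nth.
exists e; split=> [i j|x xe].
  have eij k : (k <= maxn i j)%N -> (k < size (gram_schmidt (N (maxn i j).+1)))%N.
    by move=> /leq_ltn_trans; apply; exact: NP.
  rewrite -!(eE (N (maxn i j).+1)) ?eij ?leq_maxl ?leq_maxr//.
  by apply: gram_schmidt_orthonormal; rewrite eij ?leq_maxl ?leq_maxr.
apply: dt => n; apply: gram_schmidt_span => v /(nthP 0)[k kn <-].
by rewrite eE.
Qed.

End GramSchmidt.

Lemma separable_basis (R : realType) (H : hilbertType R) :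
  separable H -> infinite_dimensional H -> exists e : nat -> H, hilbert_basis e.
Proof.
move=> /separable_seq[d dd] Hinf; apply: (@gram_schmidt_basis _ _ d) => // x xd.
apply: (@approx_orth _ _ (range d)) => [e /(dd x)[n xn]|_ [n _ <-]//].
by exists (d n) => //; exists n.
Qed.

Section Adjoints.
Variable R : realType.
Implicit Types H K : hilbertType R.

Lemma hlim_inner_eq2 H K (u : nat -> H) (v : nat -> K) l m y z :
  hlim u l -> hlim v m -> (forall n, inner (u n) y = inner (v n) z) ->
  inner l y = inner m z.
Proof.
move=> /(@hlim_inner _ _ _ _ y) ul /(@hlim_inner _ _ _ _ z) vm uv.
apply/eqP; rewrite -subr_eq0; apply/eqP/eq0_normc/eqP.
rewrite eq_le normc_ge0 andbT; apply/ler_addgt0Pr => e e0; rewrite add0r.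
have e20 : 0 < e / 2 by rewrite divr_gt0.
have /cvgr0Pnorm_lt/(_ _ e20)[N _ uN] := ul.
have /cvgr0Pnorm_lt/(_ _ e20)[M _ vM] := vm.
have := uN (maxn N M); have := vM (maxn N M).
rewrite /= leq_maxl leq_maxr => /(_ isT) h1 /(_ isT) h2.
rewrite -(subrKA (inner (u (maxn N M)) y)) (le_trans (le_normcD _ _))//.
rewrite (splitr e) lerD// ltW//; last by rewrite uv (le_lt_trans _ h1)// ler_norm.
by rewrite -opprB normcN (le_lt_trans _ h2)// ler_norm.
Qed.

(** The adjoint is the series of <z, f (e i)> e_i. For a partial sum [w] one has <z, f w> = |w|^2,
    so |w|^2 <= |z| M |w|, which is the bound needed for convergence. *)
Lemma ex_adjoint H K (e : nat -> H) (f : H -> K) M : hilbert_basis e -> lbnd f M ->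
  exists2 g : K -> H, lbnd g M & forall x y, inner (f x) y = inner x (g y).
Proof.
move=> eb fM; have [eo et] := eb; have [lf M0 bf] := fM.
have oF (z : K) i j : i != j ->
    inner (inner z (f (e i)) *: e i) (inner z (f (e j)) *: e j) = 0.
  exact: (@orthonormal_orthZ _ _ _ (fun k => inner z (f (e k)))).
have [|i a x y|i j z ij|n z|g gM gS] :=
  @orth_series_map _ K H (fun i z => inner z (f (e i)) *: e i) M.
- by [].
- by rewrite inner_linear scalerDl scalerA.
- exact: oF.
- rewrite -(@rnorm_sqr_sum _ _ (fun i => inner z (f (e i)) *: e i)) ?iota_uniq//;
    last exact: oF.
  set w := \sum_(i <- _) _.
  have := CauchySchwarz_inner z (f w).
  have -> : inner z (f w) = (rnorm w ^+ 2)%:C%C.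
    rewrite (lin_sum lf) inner_sumr rnorm_sqr_sum ?iota_uniq//; last exact: oF.
    rewrite rmorph_sum/=; apply: eq_bigr => i _.
    rewrite (linZ lf) innerZr conjc_sqr rnormZ orthonormal_rnorm// mulr1//.
  rewrite normc_real ?sqr_ge0// => h.
  have {h} := le_trans h (ler_wpM2l (rnorm_ge0 z) (bf w)).
  rewrite ler_pXn2r ?nnegrE ?mulr_ge0 ?rnorm_ge0// expr2 mulrA (mulrC (rnorm z)).
  have [->|w0] := eqVneq (rnorm w) 0; first by rewrite mulr_ge0 ?rnorm_ge0.
  by rewrite ler_pM2r// lt_def w0 rnorm_ge0.
exists g => // x y; move: x; apply: (basis_ind eb).
- by rewrite (lin0 lf) !inner0l.
- by move=> a x x' hx hx'; rewrite lf !inner_linear hx hx'.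
- by move=> u l Pu ul; apply: hlim_inner_eq2 (lbnd_hlim fM ul) ul Pu.
- move=> i; rewrite innerC [RHS]innerC; congr conjc.
  by apply/esym/(@orthonormal_series_coef _ _ _ (fun k => inner y (f (e k)))).
Qed.

Lemma is_adjoint_sym H (S T : bop H) : is_adjoint S T -> is_adjoint T S.
Proof. by move=> ST x y; rewrite innerC -ST -innerC. Qed.

Lemma is_adjoint_unique H (S T T' : bop H) :
  is_adjoint S T -> is_adjoint S T' -> T = T'.
Proof.
move=> ST ST'; apply: bop_ext => y; apply: inner_inj => x.
by rewrite innerC -ST ST' -innerC.
Qed.

Lemma is_adjointD H (S T S' T' : bop H) :
  is_adjoint S T -> is_adjoint S' T' -> is_adjoint (S + S') (T + T').
Proof. by move=> ST ST' x y; rewrite !bopDE innerDl innerDr ST ST'. Qed.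

Lemma is_adjointZ H c (S T : bop H) :
  is_adjoint S T -> is_adjoint (c *: S) (conjc c *: T).
Proof. by move=> ST x y; rewrite !bopZE innerZl innerZr conjcK ST. Qed.

Lemma is_adjointB H (S T S' T' : bop H) :
  is_adjoint S T -> is_adjoint S' T' -> is_adjoint (S - S') (T - T').
Proof. by move=> ST ST' x y; rewrite !bopBE innerBl innerBr ST ST'. Qed.

Lemma is_adjoint0 H : is_adjoint (0 : bop H) 0.
Proof. by move=> x y; rewrite !bop0E inner0l inner0r. Qed.

Lemma is_adjoint_comp H (S T S' T' : bop H) :
  is_adjoint S T -> is_adjoint S' T' -> is_adjoint (bop_comp S S') (bop_comp T' T).
Proof. by move=> ST ST' x y; rewrite /= ST ST'. Qed.

(** |T y|^2 = <S (T y), y> <= |S| |T y| |y|, and a factor |T y| cancels. *)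
Lemma opnorm_adjoint H (S T : bop H) : is_adjoint S T -> opnorm T <= opnorm S.
Proof.
move=> ST; apply: opnorm_le; first exact: opnorm_ge0.
move=> y; have [->|y0] := eqVneq (rnorm (T y)) 0.
  by rewrite mulr_ge0 ?opnorm_ge0 ?rnorm_ge0.
have := CauchySchwarz_inner (S (T y)) y.
rewrite ST inner_self normc_real ?sqr_ge0// => h.
have {h} := le_trans h (ler_wpM2r (rnorm_ge0 y) (opnormP S (T y))).
rewrite expr2 mulrAC ler_pM2r// lt_def y0 rnorm_ge0//.
Qed.

(** A functional form of [is_adjoint], in which words and operator-valued maps can be written. With
    a basis the adjoint exists ([adjP]), so the default 0 never occurs. *)
Definition adj H (T : bop H) : bop H := xget 0 [set S | is_adjoint T S].

Lemma adjP H (e : nat -> H) (T : bop H) : hilbert_basis e -> is_adjoint T (adj T).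
Proof.
move=> eb; have [g gM fg] := ex_adjoint eb (bop_lbnd T).
rewrite /adj; case: xgetP => [S _ //|/(_ (mkbop g))[]] x y.
by rewrite (mkbopE gM).
Qed.

End Adjoints.

(** * Tensor products of operators *)

Section BasisExtension.
Variable R : realType.
Implicit Types H K : hilbertType R.

Lemma lbnd_basis_ext H K (e : nat -> H) (f g : H -> K) M N :
  hilbert_basis e -> lbnd f M -> lbnd g N -> (forall i, f (e i) = g (e i)) ->
  f = g.
Proof.
move=> eb fM gN fg; have [lf _ _] := fM; have [lg _ _] := gN; apply/funext.
apply: (basis_ind eb) => // [|a x y fx fy|u l fu ul].
- by rewrite (lin0 lf) (lin0 lg).
- by rewrite lf lg fx fy.
- apply: (hlim_unique (lbnd_hlim fM ul)).
  by have := lbnd_hlim gN ul; congr (hlim _ _); apply/funext => n /=; rewrite fu.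
Qed.

(** [U] turns coefficients along [E] into coefficients along [e], and [V] is its adjoint. They
    exchange [E i] and [e i], so both composites agree with the identity on a basis. *)
Lemma basis_unitary H K (E : nat -> K) (e : nat -> H) :
  hilbert_basis E -> hilbert_basis e ->
  exists U : K -> H, exists V : H -> K,
    [/\ lbnd U 1, lbnd V 1, cancel U V, cancel V U &
        forall z x, inner (U z) x = inner z (V x)].
Proof.
move=> Eb eb; have [Eo _] := Eb; have [eo _] := eb.
have [||i j z ij|n z|U U1 US] :=
  @orth_series_map _ K H (fun i z => inner z (E i) *: e i) 1.
- by [].
- by move=> i a x y; rewrite inner_linear scalerDl scalerA.
- exact: (@orthonormal_orthZ _ _ _ (fun k => inner z (E k))).
- under eq_bigr do rewrite rnormZ orthonormal_rnorm// mulr1.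
  by rewrite mul1r; exact: bessel.
have Ue z i : inner (U z) (e i) = inner z (E i).
  exact: (@orthonormal_series_coef _ _ _ (fun k => inner z (E k))).
have [V V1 UV] := ex_adjoint Eb U1.
have VE i : V (e i) = E i.
  by apply: inner_inj => z; rewrite innerC -UV Ue -innerC.
have UE i : U (E i) = e i.
  apply: inner_inj; apply: (basis_ind eb) => [|a x y hx hy|u l hu ul|j].
  - by rewrite !inner0r.
  - by rewrite !innerDr !innerZr hx hy.
  - rewrite innerC [RHS]innerC; congr conjc.
    by apply: (hlim_inner_eq2 ul ul) => n; rewrite innerC hu -innerC.
  - by rewrite Ue Eo eo.
have id1 (L : hilbertType R) : lbnd (@id L) 1.
  by split=> // x; rewrite mul1r.
exists U, V; split => //.
- have VU : V \o U = id.
    by apply: (lbnd_basis_ext Eb (lbnd_comp V1 U1) (id1 K)) => i /=; rewrite UE VE.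
  by move=> z; exact: (congr1 (@^~ z) VU).
- have UV' : U \o V = id.
    by apply: (lbnd_basis_ext eb (lbnd_comp U1 V1) (id1 H)) => i /=; rewrite VE UE.
  by move=> x; exact: (congr1 (@^~ x) UV').
Qed.

End BasisExtension.

Section TensorOperators.
Variables (R : realType) (H K : hilbertType R).

(** [hilbert_tensor] for a bare function, with density of the span of simple tensors replaced by
    totality. This form is visibly symmetric in the two factors, so [tensor_flip] reduces 1 (x) T to
    T (x) 1. *)
Definition tensor_map (t : H -> H -> K) : Prop :=
  [/\ forall x, linear (t x), forall y, linear (t^~ y),
      forall x y x' y', inner (t x y) (t x' y') = inner x x' * inner y y' &
      forall z, (forall x y, inner z (t x y) = 0) -> z = 0].

Lemma hilbert_tensor_map (t : {bilinear H -> H -> K}) :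
  hilbert_tensor t -> tensor_map t.
Proof.
move=> [tm td]; split => // [x a y y'|y a x x'|z zt].
- exact: linearPr.
- exact: linearPl.
- apply: (dense_orth td) => _ [n [x [y ->]]].
  by rewrite inner_sumr big1.
Qed.

Variable t : H -> H -> K.
Hypothesis tm : tensor_map t.
Variable e : nat -> H.
Hypothesis eb : hilbert_basis e.

Lemma tensor_flip : tensor_map (fun x y => t y x).
Proof.
have [t1 t2 t3 t4] := tm; split => // [x y x' y'|z zt]; first by rewrite t3 mulrC.
exact: t4.
Qed.

Lemma rnorm_tensor x y : rnorm (t x y) = rnorm x * rnorm y.
Proof.
have [_ _ t3 _] := tm; have := t3 x y x y.
rewrite !inner_self -rmorphM -exprMn => /complexI/eqP.
by rewrite eqrXn2 ?mulr_ge0 ?rnorm_ge0// => /eqP.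
Qed.

Lemma tensor_lbndl y : lbnd (t^~ y) (rnorm y).
Proof.
have [_ t2 _ _] := tm; split => //; first exact: rnorm_ge0.
by move=> x; rewrite rnorm_tensor mulrC.
Qed.

Lemma tensor_lbndr x : lbnd (t x) (rnorm x).
Proof.
have [t1 _ _ _] := tm; split => //; first exact: rnorm_ge0.
by move=> y; rewrite rnorm_tensor.
Qed.

(** [V] is the adjoint of [t^~ y], that is, the partial inner product with [y] in the second
    factor. *)
Lemma tensor_slice y : exists V : K -> H, [/\ lbnd V (rnorm y),
  (forall x z, inner (t x y) z = inner x (V z)) &
  (forall x x', V (t x x') = inner x' y *: x)].
Proof.
have [_ _ t3 _] := tm; have [V Vy tV] := ex_adjoint eb (tensor_lbndl y).
exists V; split=> // x x'; apply: inner_inj => w.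
by rewrite innerC -tV t3 rmorphM /= -!innerC innerZl mulrC.
Qed.

(* With the isometries [W_i x = t x (e i)], whose ranges are pairwise
   orthogonal, S (x) 1 is the sum of the operators W_i S W_i^*. *)
Lemma ex_tensor_left (S : bop H) : exists2 G : K -> K, lbnd G (opnorm S) &
  forall x y, G (t x y) = t (S x) y.
Proof.
have [t1 t2 t3 _] := tm; have [eo _] := eb.
have e1 i : rnorm (e i) = 1 by exact: orthonormal_rnorm.
have te i j x y : i != j -> inner (t x (e i)) (t y (e j)) = 0.
  by move=> /negPf ij; rewrite t3 eo ij mulr0.
have [V VP] := choice (fun i => tensor_slice (e i)).
have VtE i x z : inner (t x (e i)) z = inner x (V i z) by have [_ ? _] := VP i.
have lV i : linear (V i) by have [[]] := VP i.
have [||i j z ij|n z|G GM GS] :=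
  @orth_series_map _ K K (fun i z => t (S (V i z)) (e i)) (opnorm S).
- exact: opnorm_ge0.
- by move=> i a x y; rewrite lV (bop_linear S) (t2 (e i)).
- exact: te.
(* The [t (V i z) (e i)] are the components of [z] in the orthogonal ranges, so their square sum is
   at most |z|^2; applying [S] costs a factor |S|^2. *)
- have h : \sum_(0 <= i < n) rnorm (t (V i z) (e i)) ^+ 2 <= rnorm z ^+ 2.
    apply: bessel_gen => [i j|i]; first exact: te.
    by rewrite innerC VtE inner_self conjc_real rnorm_tensor e1 mulr1.
  rewrite exprMn (le_trans _ (ler_wpM2l (sqr_ge0 _) h))// mulr_sumr.
  apply: ler_sum => i _; rewrite !rnorm_tensor e1 !mulr1 -exprMn.
  by rewrite ler_pXn2r ?nnegrE ?mulr_ge0 ?rnorm_ge0 ?opnorm_ge0// opnormP.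
exists G => // x y; apply: (hlim_unique (GS _)).
have := lbnd_hlim (tensor_lbndr (S x)) (fourier_expansion y eb).
congr (hlim _ _); apply/funext => n /=; rewrite (lin_sum (t1 _)).
apply: eq_bigr => i _; have [_ _ ->] := VP i.
by rewrite (linZ (bop_linear S)) (linZ (t1 _)) (linZ (t2 _)).
Qed.

Lemma ex_basis_index : exists s : nat -> nat * nat, bijective s.
Proof.
have /card_esym/card_set_bijP[s [_ si ss]] := card_nat2.
have /choice[s' s'K] p : exists n, s n = p by have [n _ <-] := ss p I; exists n.
exists s, s' => // n; apply: si; rewrite ?inE//.
Qed.

(** Orthogonality to the basis tensors extends to all simple tensors one variable at a time, and
    simple tensors are total. *)
Lemma tensor_basis : exists2 s : nat -> nat * nat, bijective s &
  hilbert_basis (fun n => t (e (s n).1) (e (s n).2)).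
Proof.
have [s bs] := ex_basis_index; exists s => //.
have [_ _ t3 t4] := tm; have [eo _] := eb; have [s' s'K sK] := bs.
split=> [m n|z ze].
  rewrite t3 !eo -natrM mulnb; congr (_%:R); rewrite -[m == n](inj_eq (bij_inj bs)).
  by case: (s m) (s n) => [i j] [k l]; rewrite xpair_eqE.
have zij i j : inner z (t (e i) (e j)) = 0 by have := ze (s' (i, j)); rewrite sK.
have inner0C (x y : K) : inner x y = 0 -> inner y x = 0.
  by rewrite innerC => xy; rewrite -[LHS]conjcK xy rmorph0.
apply: t4 => x y; apply: (inner0C); move: y; apply: (basis_ind eb) => [|a y y' hy hy'|u l hu ul|j].
- by have [t1 _ _ _] := tm; rewrite (lin0 (t1 x)) inner0l.
- by have [t1 _ _ _] := tm; rewrite t1 inner_linear hy hy' mulr0 addr0.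
- by apply: (hlim_inner_eq (lbnd_hlim (tensor_lbndr x) ul)); near=> n; exact: hu.
move: x; apply: (basis_ind eb) => [|a y y' hy hy'|u l hu ul|i].
- by have [_ t2 _ _] := tm; rewrite (lin0 (t2 _)) inner0l.
- by have [_ t2 _ _] := tm; rewrite (t2 (e j)) inner_linear hy hy' mulr0 addr0.
- by apply: (hlim_inner_eq (lbnd_hlim (tensor_lbndl (e j)) ul)); near=> n; exact: hu.
- exact: inner0C.
Unshelve. all: by end_near. Qed.

Lemma tensor_ext (f g : K -> K) M N : lbnd f M -> lbnd g N ->
  (forall x y, f (t x y) = g (t x y)) -> f = g.
Proof.
move=> fM gN fg; have [s _ Eb] := tensor_basis.
by apply: (lbnd_basis_ext Eb fM gN) => i; rewrite fg.
Qed.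

Lemma bop_tensor_ext (S T : bop K) : (forall x y, S (t x y) = T (t x y)) -> S = T.
Proof.
move=> ST; apply: bop_ext => z.
by rewrite (tensor_ext (bop_lbnd S) (bop_lbnd T) ST).
Qed.

End TensorOperators.

Section TensorOp.
Variables (R : realType) (H K : hilbertType R) (t : H -> H -> K).
Hypothesis tm : tensor_map t.
Variable e : nat -> H.
Hypothesis eb : hilbert_basis e.
Implicit Types S T : bop H.

Definition tensor_op S T : bop K :=
  xget 0 [set U : bop K | forall x y, U (t x y) = t (S x) (T y)].

(** S (x) T is the composite of S (x) 1 and 1 (x) T, the latter obtained from the flipped tensor
    map. The norm bound comes from this construction and is carried to the chosen operator by
    uniqueness. *)
Lemma tensor_op_spec S T : (forall x y, tensor_op S T (t x y) = t (S x) (T y)) /\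
  opnorm (tensor_op S T) <= opnorm S * opnorm T.
Proof.
have [G GS Gt] := ex_tensor_left tm eb S.
have [G' GT G't] := ex_tensor_left (tensor_flip tm) eb T.
have GG := lbnd_comp GS GT; have GGE := mkbopE GG.
have E x y : mkbop (G \o G') (t x y) = t (S x) (T y).
  by rewrite GGE /= G't Gt.
rewrite /tensor_op; case: xgetP => [U _ /= UE|/(_ (mkbop (G \o G')))[]//].
split=> //; have -> : U = mkbop (G \o G').
  by apply: (bop_tensor_ext tm eb) => x y; rewrite UE E.
by case: GG => _ ? bGG; apply: opnorm_le => // x; rewrite GGE.
Qed.

Lemma tensor_opE S T x y : tensor_op S T (t x y) = t (S x) (T y).
Proof. by have [] := tensor_op_spec S T. Qed.

Lemma opnorm_tensor_op S T : opnorm (tensor_op S T) <= opnorm S * opnorm T.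
Proof. by have [] := tensor_op_spec S T. Qed.

Lemma tensor_op_unique S T (U : bop K) :
  (forall x y, U (t x y) = t (S x) (T y)) -> U = tensor_op S T.
Proof. by move=> UE; apply: (bop_tensor_ext tm eb) => x y; rewrite UE tensor_opE. Qed.

Lemma tensor_op_linearl T : linear (tensor_op^~ T).
Proof.
have [_ t2 _ _] := tm; move=> a S S'; apply/esym/tensor_op_unique => x y.
by rewrite bopDE bopZE !tensor_opE -(t2 (T y)).
Qed.

Lemma tensor_op_linearr S : linear (tensor_op S).
Proof.
have [t1 _ _ _] := tm; move=> a T T'; apply/esym/tensor_op_unique => x y.
by rewrite bopDE bopZE !tensor_opE -(t1 (S x)).
Qed.

Lemma tensor_op_comp S S' T T' : bop_comp (tensor_op S T) (tensor_op S' T') =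
  tensor_op (bop_comp S S') (bop_comp T T').
Proof. by apply: tensor_op_unique => x y; rewrite /= !tensor_opE. Qed.

Lemma tensor_op_adjoint S S' T T' : is_adjoint S S' -> is_adjoint T T' ->
  is_adjoint (tensor_op S T) (tensor_op S' T').
Proof.
have [_ _ t3 _] := tm; move=> SS' TT' z w.
have [s _ Eb] := tensor_basis tm eb.
have bl := bop_lbnd (tensor_op S T); have br := bop_lbnd (tensor_op S' T').
have [ll _ _] := bl; have [lr _ _] := br.
move: z; apply: (basis_ind Eb) => [|a z z' hz hz'|u l hu ul|i].
- by rewrite (lin0 ll) !inner0l.
- by rewrite ll !inner_linear hz hz'.
- by apply: (hlim_inner_eq2 (lbnd_hlim bl ul) ul).
rewrite innerC [RHS]innerC; congr conjc; move: w.
apply: (basis_ind Eb) => [|a z z' hz hz'|u l hu ul|j].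
- by rewrite (lin0 lr) !inner0l.
- by rewrite lr !inner_linear hz hz'.
- by apply: (hlim_inner_eq2 ul (lbnd_hlim br ul)).
- by rewrite !tensor_opE !t3; congr (_ * _); rewrite innerC ?SS' ?TT' -innerC.
Qed.

End TensorOp.

(** * Generated C*-algebras *)

Section CstarClosures.
Variables (R : realType) (H : hilbertType R).
Implicit Types (A W : set (bop H)) (S T : bop H).

Lemma lin_span_ind W (P : bop H -> Prop) : P 0 ->
  (forall a S T, P S -> P T -> P (a *: S + T)) -> (forall S, W S -> P S) ->
  forall T, lin_span W T -> P T.
Proof.
move=> P0 PD PW T [n [c [S [WS ->]]]].
by elim/big_rec: _ => // i U _ PU; apply: PD => //; apply: PW.
Qed.

Lemma sub_lin_span W : W `<=` lin_span W.
Proof.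
move=> S WS; exists 1%N, (fun=> 1), (fun=> S); split => //.
by rewrite big_ord1 scale1r.
Qed.

Lemma lin_span0 W : lin_span W 0.
Proof.
by exists 0%N, (fun=> 0), (fun=> 0); split; [case|rewrite big_ord0].
Qed.

Lemma lin_spanD W S T : lin_span W S -> lin_span W T -> lin_span W (S + T).
Proof.
move=> [m [c [U [WU ->]]]] [n [d [V [WV ->]]]].
exists (m + n)%N, (fun i => match fintype.split i with inl j => c j | inr k => d k end),
  (fun i => match fintype.split i with inl j => U j | inr k => V k end).
split; first by move=> i; case: fintype.splitP.
rewrite big_split_ord; congr (_ + _); apply: eq_bigr => i _.
  by rewrite -[lshift n i]/(unsplit (inl i)) unsplitK.
by rewrite -[rshift m i]/(unsplit (inr i)) unsplitK.
Qed.

Lemma lin_spanZ W a S : lin_span W S -> lin_span W (a *: S).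
Proof.
move=> [m [c [U [WU ->]]]]; exists m, (fun i => a * c i), U; split => //.
by rewrite scaler_sumr; apply: eq_bigr => i _; rewrite scalerA.
Qed.

Lemma sub_norm_closure A : A `<=` norm_closure A.
Proof. by move=> S AS e e0; exists S => //; rewrite subrr opnorm0. Qed.

Lemma norm_closureS A W : A `<=` W -> norm_closure A `<=` norm_closure W.
Proof. by move=> AW T AT e /AT[S /AW WS]; exists S. Qed.

Lemma norm_closure_idem A : norm_closure (norm_closure A) `<=` norm_closure A.
Proof.
move=> T AT e e0; have e20 : 0 < e / 2 by rewrite divr_gt0.
have [S AS TS] := AT _ e20; have [U AU SU] := AS _ e20; exists U => //.
by rewrite -(subrKA S) (le_lt_trans (opnormD _ _))// (splitr e) ltrD.
Qed.

Lemma bop_compDl S S' T : bop_comp (S + S') T = bop_comp S T + bop_comp S' T.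
Proof. exact: bop_ext. Qed.

Lemma bop_compZl a S T : bop_comp (a *: S) T = a *: bop_comp S T.
Proof. exact: bop_ext. Qed.

Lemma bop_compDr S T T' : bop_comp S (T + T') = bop_comp S T + bop_comp S T'.
Proof. by apply: bop_ext => x; exact: (linD (bop_linear S)). Qed.

Lemma bop_compZr a S T : bop_comp S (a *: T) = a *: bop_comp S T.
Proof. by apply: bop_ext => x; exact: (linZ (bop_linear S)). Qed.

Lemma bop_comp0l T : bop_comp 0 T = 0. Proof. exact: bop_ext. Qed.

Lemma bop_comp0r S : bop_comp S 0 = 0.
Proof. by apply: bop_ext => x; exact: (lin0 (bop_linear S)). Qed.

Lemma bop_compBB S S' T T' : bop_comp S T - bop_comp S' T' =
  bop_comp (S - S') T + bop_comp S' (T - T').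
Proof.
apply: bop_ext => x.
change (S (T x) - S' (T' x) = (S (T x) - S' (T x)) + S' (T x - T' x)).
by rewrite (linB (bop_linear S')) addrA subrK.
Qed.

(** Products and adjoints extend from [W] to its span by linearity and to the closure by norm
    continuity. Both nonempty words and simple tensor operators form such a set. *)
Lemma cstar_closure W :
  (forall S T, W S -> W T -> W (bop_comp S T)) ->
  (forall S, W S -> exists2 T, W T & is_adjoint S T) ->
  cstar_subalgebra (norm_closure (lin_span W)).
Proof.
move=> WM Wa; set L := lin_span W.
have LM S T : L S -> L T -> L (bop_comp S T).
  move=> LS LT; move: S LS; apply: lin_span_ind => [|a S S' h h'|S WS].
  - by rewrite bop_comp0l; exact: lin_span0.
  - by rewrite bop_compDl bop_compZl; apply: lin_spanD => //; exact: lin_spanZ.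
  move: T LT; apply: lin_span_ind => [|a T T' h h'|T WT].
  - by rewrite bop_comp0r; exact: lin_span0.
  - by rewrite bop_compDr bop_compZr; apply: lin_spanD => //; exact: lin_spanZ.
  - by apply: sub_lin_span; exact: WM.
have La S : L S -> exists2 T, L T & is_adjoint S T.
  move: S; apply: lin_span_ind => [|a S S' [T LT ST] [T' LT' ST']|S WS].
  - by exists 0; [exact: lin_span0|exact: is_adjoint0].
  - exists (conjc a *: T + T'); first by apply: lin_spanD => //; exact: lin_spanZ.
    by apply: is_adjointD => //; exact: is_adjointZ.
  - by have [T WT ST] := Wa S WS; exists T => //; exact: sub_lin_span.
split=> [|S T clS clT e e0|S T clT TS e e0|]; last exact: norm_closure_idem.
- split=> [|S T clS clT e e0|c T clT e e0].
  + by apply: sub_norm_closure; exact: lin_span0.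
  + have e20 : 0 < e / 2 by rewrite divr_gt0.
    have [S' LS' SS'] := clS _ e20; have [T' LT' TT'] := clT _ e20.
    exists (S' + T'); first exact: lin_spanD.
    by rewrite opprD addrACA (le_lt_trans (opnormD _ _))// (splitr e) ltrD.
  + have c0 : 0 < normc c + 1 by rewrite ltr_wpDl ?normc_ge0.
    have [|T' LT' TT'] := clT (e / (normc c + 1)); first by rewrite divr_gt0.
    exists (c *: T'); first exact: lin_spanZ.
    rewrite -scalerBr (le_lt_trans (opnormZ _ _))//.
    rewrite ltr_pdivlMr// in TT'; apply: le_lt_trans TT'.
    by rewrite mulrC ler_wpM2l ?opnorm_ge0// lerDl.
(* The accuracy asked of [T'] depends on the norm of [S'], so [S'] is chosen first; the added 1
   keeps the denominators positive. *)
- have e20 : 0 < e / 2 by rewrite divr_gt0.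
  have T0 : 0 < opnorm T + 1 by rewrite ltr_wpDl ?opnorm_ge0.
  have [|S' LS' SS'] := clS (e / 2 / (opnorm T + 1)); first by rewrite divr_gt0.
  have S0 : 0 < opnorm S' + 1 by rewrite ltr_wpDl ?opnorm_ge0.
  have [|T' LT' TT'] := clT (e / 2 / (opnorm S' + 1)); first by rewrite divr_gt0.
  exists (bop_comp S' T'); first exact: LM.
  rewrite bop_compBB (le_lt_trans (opnormD _ _))// (splitr e).
  rewrite ltr_pdivlMr// in SS'; rewrite ltr_pdivlMr// in TT'.
  rewrite ltrD// (le_lt_trans (opnormM _ _))//.
    by apply: le_lt_trans SS'; rewrite ler_wpM2l ?opnorm_ge0// lerDl.
  by apply: le_lt_trans TT'; rewrite mulrC ler_wpM2l ?opnorm_ge0// lerDl.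
- have [T' LT' TT'] := clT _ e0; have [S' LS' TS'] := La _ LT'; exists S' => //.
  apply: le_lt_trans TT'; apply: opnorm_adjoint.
  exact: is_adjointB.
Qed.

Lemma Cstar_cstar (g : Gamma H) : cstar_subalgebra (Cstar g).
Proof.
split=> [|S T gS gT B [Bc Bg]|S T gT TS B [Bc Bg]|T clT B [Bc Bg]].
- split=> [B [[[]]]|S T gS gT B [Bc Bg]|c T gT B [Bc Bg]]//.
  + by have [[_ BD _] _ _ _] := Bc; apply: BD; [exact: gS|exact: gT].
  + by have [[_ _ BZ] _ _ _] := Bc; apply: BZ; exact: gT.
- by have [_ BM _ _] := Bc; apply: BM; [exact: gS|exact: gT].
- by have [_ _ Ba _] := Bc; apply: Ba TS; exact: gT.
- have [_ _ _ Bcl] := Bc; apply: Bcl; apply: norm_closureS clT => S gS.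
  exact: gS.
Qed.

Lemma Cstar_gen (g : Gamma H) n : Cstar g (g n).
Proof. by move=> B [_]; apply; exists n. Qed.

Lemma Cstar_min (g : Gamma H) A : cstar_subalgebra A -> (forall n, A (g n)) ->
  Cstar g `<=` A.
Proof. by move=> Ac Ag T; apply; split => // _ [n _ <-]. Qed.

End CstarClosures.

Section StarMorphisms.
Variables (R : realType) (H K : hilbertType R).
Variable phi : bop H -> bop K.

(** Contractivity is required outright instead of being deduced from the algebraic laws by spectral
    theory; amplification and conjugation come with an explicit bound. *)
Definition star_contraction : Prop :=
  [/\ linear phi,
      forall S T, phi (bop_comp S T) = bop_comp (phi S) (phi T),
      forall S T, is_adjoint S T -> is_adjoint (phi S) (phi T) &
      forall T, opnorm (phi T) <= opnorm T].

Hypothesis phis : star_contraction.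

Let phiZD a S T : phi (a *: S + T) = a *: phi S + phi T.
Proof. by have [l _ _ _] := phis; rewrite l. Qed.

Let phiD S T : phi (S + T) = phi S + phi T.
Proof. by rewrite -[S in LHS]scale1r phiZD scale1r. Qed.

Let phi0 : phi 0 = 0.
Proof. by apply: (addrI (phi 0)); rewrite -phiD !addr0. Qed.

Let phiZ a T : phi (a *: T) = a *: phi T.
Proof. by rewrite -[a *: T]addr0 phiZD phi0 addr0. Qed.

Let phiB S T : phi (S - T) = phi S - phi T.
Proof. by rewrite phiD -scaleN1r phiZ scaleN1r. Qed.

Lemma star_preimage (B : set (bop K)) :
  cstar_subalgebra B -> cstar_subalgebra (phi @^-1` B).
Proof.
have [_ phiM phia phin] := phis; move=> [[B0 BD BZ] BM Ba Bcl].
split=> [|S T BS BT|S T BT TS|T clT].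
- split=> [|S T BS BT|c T BT]; rewrite /preimage/= ?phi0 ?phiD ?phiZ//.
  + exact: BD.
  + exact: BZ.
- by rewrite /preimage/= phiM; exact: BM.
- by rewrite /preimage/=; apply: Ba (phia _ _ TS).
- apply: Bcl => e e0; have [S BS TS] := clT e e0; exists (phi S) => //.
  by rewrite -phiB (le_lt_trans (phin _)).
Qed.

(* A contractive linear left inverse of [phi] replaces the completeness of
   B(H) in the proof that the image of a norm-closed set is norm closed. *)
Variables (psi : bop K -> bop H) (e : nat -> H).
Hypothesis eb : hilbert_basis e.
Hypothesis psiK : cancel phi psi.
Hypothesis psiB : forall S T, psi (S - T) = psi S - psi T.
Hypothesis psin : forall T, opnorm (psi T) <= opnorm T.

Lemma star_image (A : set (bop H)) :
  cstar_subalgebra A -> cstar_subalgebra (phi @` A).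
Proof.
have [_ phiM phia phin] := phis; move=> [[A0 AD AZ] AM Aa Acl].
split=> [|_ _ [S AS <-] [T AT <-]|S _ [T AT <-] TS|T clT].
- split=> [|_ _ [S AS <-] [T AT <-]|c _ [T AT <-]].
  + by exists 0.
  + by exists (S + T); [exact: AD|exact: phiD].
  + by exists (c *: T); [exact: AZ|exact: phiZ].
- by exists (bop_comp S T); [exact: AM|exact: phiM].
- have Ta := adjP T eb; exists (adj T); first exact: Aa Ta.
  exact: is_adjoint_unique (phia _ _ Ta) TS.
- exists (psi T).
    apply: Acl => d d0; have [_ [S AS <-] TS] := clT d d0; exists S => //.
    by rewrite -(psiK S) -psiB (le_lt_trans (psin _)).
  (* [phi (psi T)] and [T] both lie within d / 2 of the same [phi S], for every d, so they
     coincide. *)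
  apply/eqP; rewrite -subr_eq0; apply/eqP/bop_ext => x.
  apply: rnorm0_eq0; apply/eqP; rewrite eq_le rnorm_ge0 andbT.
  rewrite (le_trans (opnormP _ _))// -[leRHS](mul0r (rnorm x)) ler_wpM2r ?rnorm_ge0//.
  apply/ler_addgt0Pr => d d0; rewrite add0r.
  have [|_ [S AS <-] TS] := clT (d / 2); first by rewrite divr_gt0.
  rewrite -(subrKA (phi S)) (le_trans (opnormD _ _))// (splitr d) lerD//.
    rewrite -phiB (le_trans (phin _))// -{1}(psiK S) -psiB (le_trans (psin _))//.
    by rewrite (le_trans _ (ltW TS))// -opprB opnormN.
  by rewrite (le_trans _ (ltW TS))// -opprB opnormN.
Qed.

(** Both inclusions follow from minimality of a generated algebra, the first by [star_preimage] and
    the second by [star_image]. *)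
Lemma Cstar_image (g : Gamma H) : phi @` Cstar g = Cstar ((phi \o g) : Gamma K).
Proof.
apply/seteqP; split.
  move=> _ [T gT <-].
  have : Cstar g `<=` phi @^-1` Cstar ((phi \o g) : Gamma K).
    apply: Cstar_min; first by apply: star_preimage; exact: Cstar_cstar.
    by move=> n; exact: (@Cstar_gen _ _ ((phi \o g) : Gamma K)).
  by apply.
apply: Cstar_min; first by apply: star_image; exact: Cstar_cstar.
by move=> n; exists (g n) => //; exact: Cstar_gen.
Qed.

End StarMorphisms.

Section Words.
Variables (R : realType) (H : hilbertType R).
Variable e : nat -> H.
Hypothesis eb : hilbert_basis e.
Implicit Types (g : nat -> bop H) (s : seq (nat * bool)).

Definition letter g (p : nat * bool) : bop H := if p.2 then adj (g p.1) else g p.1.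

Definition word g s : bop H := foldr (fun p => bop_comp (letter g p)) (bop_id H) s.

(** The empty word is the identity, which need not belong to C*(g). *)
Definition words g : set (bop H) := [set word g s | s in [set s | s != [::]]].

Lemma word_cat g s s' : word g (s ++ s') = bop_comp (word g s) (word g s').
Proof.
elim: s => [|p s IH] /=; first exact: bop_ext.
by rewrite IH; exact: bop_ext.
Qed.

Lemma word1 g p : word g [:: p] = letter g p.
Proof. exact: bop_ext. Qed.

Lemma letter_adjoint g p : is_adjoint (letter g p) (letter g (p.1, ~~ p.2)).
Proof.
by case: p => n []; rewrite /letter/=; [apply: is_adjoint_sym|]; exact: adjP eb.
Qed.

Lemma word_adjoint g s :
  is_adjoint (word g s) (word g (rev [seq (p.1, ~~ p.2) | p <- s])).
Proof.
elim: s => [//|p s IH].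
rewrite [map _ _]/= rev_cons -cats1 word_cat word1.
exact: is_adjoint_comp (letter_adjoint g p) IH.
Qed.

(** Concatenation multiplies words, and reversal with flipped flags takes adjoints, so
    [cstar_closure] applies to the nonempty words. *)
Lemma Cstar_words (g : Gamma H) : Cstar g `<=` norm_closure (lin_span (words g)).
Proof.
apply: Cstar_min => [|n].
  apply: cstar_closure => [_ _ [s /= s0 <-] [s' _ <-]|_ [s /= s0 <-]].
    by exists (s ++ s'); [case: s s0|exact: word_cat].
  exists (word g (rev [seq (p.1, ~~ p.2) | p <- s])); last exact: word_adjoint.
  by eexists => //; rewrite /= -size_eq0 size_rev size_map size_eq0.
apply: sub_norm_closure; apply: sub_lin_span; exists [:: (n, false)] => //.
exact: word1.
Qed.

Lemma words_Cstar (g : Gamma H) : words g `<=` Cstar g.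
Proof.
have [_ gM ga _] := Cstar_cstar g.
have gl p : Cstar g (letter g p).
  by case: p => n [] /=; [apply: ga (adjP _ eb)|]; exact: Cstar_gen.
move=> _ [s s0 <-]; elim: s s0 => // p [_ _|q s IH _]; first by rewrite word1.
by apply: gM => //; exact: IH.
Qed.

End Words.

(** * The spatial tensor product *)

Section MinTensor.
Variables (R : realType) (H K : hilbertType R) (t : {bilinear H -> H -> K}).
Hypothesis Ht : hilbert_tensor t.
Variable e : nat -> H.
Hypothesis eb : hilbert_basis e.

Let tm : tensor_map t := hilbert_tensor_map Ht.
Local Notation "S ** T" := (tensor_op t S T) (at level 40).

Lemma is_tensor_opP S T (U : bop K) : is_tensor_op t S T U <-> U = S ** T.
Proof.
split=> [/(tensor_op_unique tm eb)//|->] x y.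
exact: (tensor_opE tm eb).
Qed.

Lemma min_tensor_cstar A B : cstar_subalgebra A -> cstar_subalgebra B ->
  cstar_subalgebra (min_tensor t A B).
Proof.
move=> [_ AM Aa _] [_ BM Ba _]; apply: cstar_closure.
  move=> _ _ [S [T [AS BT /is_tensor_opP ->]]] [S' [T' [AS' BT' /is_tensor_opP ->]]].
  exists (bop_comp S S'), (bop_comp T T'); split; [exact: AM|exact: BM|].
  by apply/is_tensor_opP; rewrite (tensor_op_comp tm eb).
move=> _ [S [T [AS BT /is_tensor_opP ->]]].
have Sa := adjP S eb; have Ta := adjP T eb.
exists (adj S ** adj T); last exact: (tensor_op_adjoint tm eb).
by exists (adj S), (adj T); split; [exact: Aa Sa|exact: Ba Ta|exact/is_tensor_opP].
Qed.

(** Indices that code no pair, or a pair with an empty word, give 0, which adds nothing to the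
    generated algebra. *)
Definition tensor_gens (g d : nat -> bop H) (n : nat) : bop K :=
  if unpickle n is Some (s, s') then
    if (s != [::]) && (s' != [::]) then word g s ** word d s' else 0
  else 0 :> bop K.

(** Made for tensoring with a fixed operator, which is linear and bounded but not multiplicative:
    the operators sent into [M] form a closed subspace. *)
Lemma closed_span_preimage W (M : set (bop K)) (f : bop H -> bop K) (C : R) :
  linear f -> 0 <= C -> (forall S, opnorm (f S) <= C * opnorm S) ->
  cstar_subalgebra M -> (forall S, W S -> M (f S)) ->
  forall S, norm_closure (lin_span W) S -> M (f S).
Proof.
move=> lf C0 fC [[M0 MD MZ] _ _ Mcl] WM S clS; apply: Mcl => d d0.
have f0 : f 0 = 0.
  by have := lf (-1) 0 0; rewrite scaler0 addr0 scaleN1r addNr.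
have C1 : 0 < C + 1 by rewrite ltr_wpDl.
have [|T WT ST] := clS (d / (C + 1)); first by rewrite divr_gt0.
exists (f T).
  move: T WT {ST}; apply: lin_span_ind => [|a T T' h h'|//]; first by rewrite f0.
  by rewrite lf; apply: MD => //; exact: MZ.
have -> : f S - f T = f (S - T).
  by rewrite [S - T]addrC -[- T]scaleN1r lf scaleN1r addrC.
rewrite (le_lt_trans (fC _))//; rewrite ltr_pdivlMr// in ST.
by apply: le_lt_trans ST; rewrite mulrC ler_wpM2l ?opnorm_ge0// lerDl.
Qed.

Lemma min_tensor_gens (g d : Gamma H) :
  min_tensor t (Cstar g) (Cstar d) = Cstar (tensor_gens g d : Gamma K).
Proof.
have gc := Cstar_cstar g; have dc := Cstar_cstar d.
set M := Cstar (tensor_gens g d : Gamma K); have Mc : cstar_subalgebra M by exact: Cstar_cstar.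
apply/seteqP; split; last first.
  apply: Cstar_min; first exact: min_tensor_cstar.
  have [[m0 _ _] _ _ _] := min_tensor_cstar gc dc.
  move=> n; rewrite /tensor_gens; case: unpickle => [[s s']|]//.
  case: ifP => // /andP[s0 s'0].
  apply: sub_norm_closure; apply: sub_lin_span.
  exists (word g s), (word d s'); split; last exact/is_tensor_opP.
    by apply: (words_Cstar eb); exists s.
  by apply: (words_Cstar eb); exists s'.
have [[M0 MD MZ] _ _ Mcl] := Mc.
have Mw s s' : s != [::] -> s' != [::] -> M (word g s ** word d s').
  move=> s0 s'0; have := @Cstar_gen _ _ (tensor_gens g d : Gamma K) (pickle (s, s')).
  by rewrite /tensor_gens pickleK s0 s'0.
have M1 S s' : Cstar g S -> s' != [::] -> M (S ** word d s').
  move=> /(Cstar_words eb) gS s'0.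
  apply: (closed_span_preimage (tensor_op_linearl tm eb _) (opnorm_ge0 (word d s')) _ Mc _ gS).
    by move=> T; rewrite mulrC; exact: (opnorm_tensor_op tm eb).
  by move=> _ [s s0 <-]; exact: Mw.
have M2 S T : Cstar g S -> Cstar d T -> M (S ** T).
  move=> gS /(Cstar_words eb) dT.
  apply: (closed_span_preimage (tensor_op_linearr tm eb _) (opnorm_ge0 S) _ Mc _ dT).
    by move=> U; exact: (opnorm_tensor_op tm eb).
  by move=> _ [s s0 <-]; exact: M1.
move=> U clU; apply: Mcl; apply: norm_closureS clU.
apply: lin_span_ind => [//|a S T MS MT|_ [S [T [gS dT /is_tensor_opP ->]]]].
  by apply: MD => //; exact: MZ.
exact: M2.
Qed.

Lemma opnorm_id_le : opnorm (bop_id H) <= 1.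
Proof. by apply: opnorm_le => // x; rewrite mul1r. Qed.

Definition amplify S : bop K := S ** bop_id H.

Lemma amplify_star : star_contraction amplify.
Proof.
split=> [|S T|S T ST|S]; first exact: (tensor_op_linearl tm eb).
- rewrite /amplify (tensor_op_comp tm eb); congr tensor_op; exact: bop_ext.
- exact: (tensor_op_adjoint tm eb).
- rewrite (le_trans (opnorm_tensor_op tm eb _ _))// -[leRHS]mulr1.
  by rewrite ler_wpM2l ?opnorm_ge0// opnorm_id_le.
Qed.

(* Compression to a slice: S (x) 1 |-> W^* (S (x) 1) W = S for the isometry
   [W x = t x (e 0)]. *)
Lemma amplify_retraction : exists psi : bop K -> bop H,
  [/\ cancel amplify psi, forall S T, psi (S - T) = psi S - psi T &
      forall T, opnorm (psi T) <= opnorm T].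
Proof.
have [V [V1 tV Vt]] := tensor_slice tm eb (e 0%N).
have [eo _] := eb; have e1 : rnorm (e 0%N) = 1 by exact: orthonormal_rnorm.
rewrite e1 in V1; have W1 := tensor_lbndl tm (e 0%N); rewrite e1 in W1.
have VW (T : bop K) : lbnd (V \o T \o t^~ (e 0%N)) (1 * opnorm T * 1).
  by apply: lbnd_comp => //; apply: lbnd_comp => //; exact: bop_lbnd.
exists (fun T => mkbop (V \o T \o t^~ (e 0%N))); split=> [S|S T|T].
- apply: bop_ext => x; rewrite (mkbopE (VW _))/= (tensor_opE tm eb) Vt.
  by rewrite eo eqxx scale1r.
- apply: bop_ext => x; rewrite bopBE !(mkbopE (VW _))/=.
  by have [lV _ _] := V1; rewrite -(linB lV).
- apply: opnorm_le; first exact: opnorm_ge0.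
  move=> x; rewrite (mkbopE (VW _)); have [_ _ b] := VW T.
  by rewrite (le_trans (b x))// mul1r mulr1.
Qed.

Lemma tensor_one_amplify (g : Gamma H) :
  tensor_one t (Cstar g) = Cstar ((amplify \o g) : Gamma K).
Proof.
have [psi [psiK psiB psin]] := amplify_retraction.
rewrite -(Cstar_image amplify_star eb psiK psiB psin).
apply/seteqP; split=> [T [S gS /is_tensor_opP ->]|_ [S gS <-]].
  by exists S.
by exists S => //; exact/is_tensor_opP.
Qed.

End MinTensor.

(** * Transport of operators along a unitary *)

Section UnitaryConjugation.
Variables (R : realType) (H K : hilbertType R) (U : K -> H) (V : H -> K).
Hypotheses (U1 : lbnd U 1) (V1 : lbnd V 1).
Hypotheses (UK : cancel U V) (VK : cancel V U).
Hypothesis UV : forall z x, inner (U z) x = inner z (V x).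

Definition conjugate (T : bop K) : bop H := mkbop (U \o T \o V).

Lemma conjugateE T x : conjugate T x = U (T (V x)).
Proof.
by rewrite /conjugate (mkbopE (lbnd_comp (lbnd_comp U1 (bop_lbnd T)) V1)).
Qed.

Lemma conjugate_star : star_contraction conjugate.
Proof.
have [lU _ _] := U1; have [lV _ _] := V1.
split=> [a S T|S T|S T ST x y|T].
- by apply: bop_ext => x; rewrite bopDE bopZE !conjugateE lU.
- by apply: bop_ext => x; rewrite /= !conjugateE UK.
- by rewrite !conjugateE UV ST innerC -UV -innerC.
- have [_ _ b] := lbnd_comp (lbnd_comp U1 (bop_lbnd T)) V1.
  apply: opnorm_le; first exact: opnorm_ge0.
  by move=> x; rewrite conjugateE (le_trans (b x))// mul1r mulr1.
Qed.

End UnitaryConjugation.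

Lemma conjugateK (R : realType) (H K : hilbertType R) (U : K -> H) (V : H -> K) :
  lbnd U 1 -> lbnd V 1 -> cancel U V -> cancel (conjugate U V) (conjugate V U).
Proof.
by move=> U1 V1 UK T; apply: bop_ext => x; rewrite !conjugateE// !UK.
Qed.

Lemma conjugateB (R : realType) (H K : hilbertType R) (U : K -> H) (V : H -> K) S T :
  lbnd U 1 -> lbnd V 1 ->
  conjugate U V (S - T) = conjugate U V S - conjugate U V T.
Proof.
move=> U1 V1; have [lU _ _] := U1; apply: bop_ext => x.
by rewrite bopBE !conjugateE// -(linB lU).
Qed.

(** * Measurability of complex-valued maps *)

Section ComplexMeasurable.
Context (dd : measure_display) (W : measurableType dd) (R : realType).
Implicit Types h k : W -> R[i].

Definition cmeas h : Prop :=
  measurable_fun setT (fun w => complex.Re (h w)) /\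
  measurable_fun setT (fun w => complex.Im (h w)).

Lemma cmeas_cst c : cmeas (fun=> c).
Proof. by split; exact: measurable_cst. Qed.

Lemma cmeasD h k : cmeas h -> cmeas k -> cmeas (fun w => h w + k w).
Proof.
move=> [h1 h2] [k1 k2]; split.
  under eq_fun do rewrite raddfD; exact: measurable_funD.
under eq_fun do rewrite raddfD; exact: measurable_funD.
Qed.

Lemma cmeasM h k : cmeas h -> cmeas k -> cmeas (fun w => h w * k w).
Proof.
move=> [h1 h2] [k1 k2]; split.
  rewrite [X in measurable_fun _ X](_ : _ = fun w =>
    complex.Re (h w) * complex.Re (k w) - complex.Im (h w) * complex.Im (k w)).
    by apply: measurable_funB; exact: measurable_funM.
  by apply/funext => w; case: (h w) (k w) => [a b] [c d].
rewrite [X in measurable_fun _ X](_ : _ = fun w =>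
  complex.Re (h w) * complex.Im (k w) + complex.Im (h w) * complex.Re (k w)).
  by apply: measurable_funD; exact: measurable_funM.
by apply/funext => w; case: (h w) (k w) => [a b] [c d].
Qed.

Lemma cmeasJ h : cmeas h -> cmeas (fun w => conjc (h w)).
Proof.
move=> [h1 h2]; split.
  by rewrite [X in measurable_fun _ X](_ : _ = fun w => complex.Re (h w))//;
    apply/funext => w; case: (h w).
rewrite [X in measurable_fun _ X](_ : _ = fun w => - complex.Im (h w)).
  exact: measurable_funN.
by apply/funext => w; case: (h w).
Qed.

Lemma cmeas_sum (I : Type) (r : seq I) (F : I -> W -> R[i]) :
  (forall i, cmeas (F i)) -> cmeas (fun w => \sum_(i <- r) F i w).
Proof.
move=> mF; elim: r => [|i r IH].
  by under eq_fun do rewrite big_nil; exact: cmeas_cst.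
by under eq_fun do rewrite big_cons; exact: cmeasD.
Qed.

Lemma Im_le_normc (a : R[i]) : `|complex.Im a| <= normc a.
Proof.
rewrite -normrN -ReiNIm (le_trans (Re_le_normc _))// normcM.
by rewrite /= expr0n expr1n add0r sqrtr1 mulr1.
Qed.

Lemma cmeas_lim (h : nat -> W -> R[i]) g : (forall n, cmeas (h n)) ->
  (forall w, (fun n => normc (h n w - g w)) @ \oo --> (0 : R)) -> cmeas g.
Proof.
move=> mh hg; split.
  apply: (@measurable_fun_cvg _ _ _ _ (fun n w => complex.Re (h n w))) => [n|w _].
    by have [] := mh n.
  exact: cvg_normc0.
apply: (@measurable_fun_cvg _ _ _ _ (fun n w => complex.Im (h n w))) => [n|w _].
  by have [] := mh n.
by apply: cvg_dist_le (hg w) => n; rewrite -raddfB Im_le_normc.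
Qed.

Lemma cmeas_normc_le h (M : R) : cmeas h -> 0 <= M ->
  measurable [set w | normc (h w) <= M].
Proof.
move=> [h1 h2] M0.
rewrite (_ : [set w | _] = (fun w => complex.Re (h w) * complex.Re (h w) +
    complex.Im (h w) * complex.Im (h w)) @^-1` `]-oo, M ^+ 2]%classic).
  rewrite -[X in measurable X]setTI.
  by apply: measurable_funD => //; exact: measurable_funM.
apply/funext => w /=; rewrite in_itv/= -!expr2.
rewrite -{1}(ger0_norm M0) -sqrtr_sqr; case: (h w) => a b /=.
by rewrite ler_sqrt// sqr_ge0.
Qed.

End ComplexMeasurable.

Section CellMeasurable.
Context (dd : measure_display) (W : measurableType dd) (R : realType).
Variables (Y : Type) (F : W -> Y) (r : nat -> Y -> R) (U B : set Y).

(* The open sets of the topology generated by the r_p are countable unions of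
   the cells on which finitely many integer parts floor (k r_p) are fixed. *)
Lemma cell_measurable :
  (forall p, measurable_fun setT (fun w => r p (F w))) ->
  measurable (F @^-1` B) ->
  (forall T, U T -> B T -> exists k, forall S, B S ->
    (forall p, (p < k)%N -> `|r p S - r p T| < k.+1%:R^-1) -> U S) ->
  measurable (F @^-1` (U `&` B)).
Proof.
move=> mr mB UB.
pose cell k (T : Y) : {ffun 'I_k -> int} := [ffun p : 'I_k => Num.floor (k.+1%:R * r p T)].
(* The index type is countable. A cell counts only if its whole part inside [B] lies in [U], so the
   union stays inside [U]. *)
pose G (i : {k : nat & {ffun 'I_k -> int}}) : set W :=
  if `[< forall S, B S -> cell (tag i) S = tagged i -> U S >]
  then F @^-1` B `&` [set w | cell (tag i) (F w) = tagged i] else set0.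
have -> : F @^-1` (U `&` B) = \bigcup_i G i.
  apply/seteqP; split=> [w [UFw BFw]|w [i _]].
    have [k kP] := UB _ UFw BFw.
    exists (Tagged (fun k => {ffun 'I_k -> int}) (cell k (F w))) => //.
    rewrite /G /=; case: asboolP => [|[]]; first by split.
    move=> S BS cS; apply: kP => // p pk.
    have := congr1 (fun f : {ffun 'I_k -> int} => f (Ordinal pk)) cS; rewrite !ffunE/=.
    set a := r p S; set b := r p (F w) => ab.
    have k0 : 0 < k.+1%:R :> R by [].
    (* Two reals with the same integer part differ by less than 1; applied to the multiples by
       [k.+1], this gives the mesh [k.+1%:R^-1]. *)
    rewrite -(ltr_pM2l k0) divff// -[k.+1%:R in X in X < _](gtr0_norm k0) -normrM mulrBr.
    have /andP[a1 a2] := floor_itv (k.+1%:R * a).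
    have /andP[b1 b2] := floor_itv (k.+1%:R * b).
    by move: a1 a2 b1 b2; rewrite ab intrD ltr_norml => *; apply/andP; split; lra.
  by rewrite /G; case: asboolP => // h [BFw /= cw]; split => //; exact: h cw.
apply: countable_bigcupT_measurable => [|[k q]]; first exact: countableP.
rewrite /G/=.
case: ifP => // _; apply: measurableI => //.
have -> : [set w | cell k (F w) = q] =
    \bigcap_(p in [set: 'I_k]) ((fun w => k.+1%:R * r p (F w)) @^-1`
       `[(q p)%:~R, (q p + 1)%:~R[%classic).
  apply/seteqP; split=> [w /= cw p _|w cw].
    by rewrite -cw ffunE/= in_itv/= floor_itv.
  apply/ffunP => p; rewrite ffunE; apply/floor_def.
  by have /= := cw p I; rewrite in_itv.
apply: fin_bigcap_measurable => // p _; rewrite -[X in measurable X]setTI.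
by apply: measurable_funM => //; exact: measurable_cst.
Qed.

End CellMeasurable.

(** * The Borel structure of the weak operator topology *)

Section WeakOperatorTopology.
Variables (R : realType) (H : hilbertType R).

(** The topology is pulled back from pointwise convergence along [wot_eval], so convergence of all
    coefficients is convergence in [wot]. *)
Lemma wot_seq (U : set (wot H)) (T : bop H) (S : nat -> bop H) :
  open U -> U T ->
  (forall x y, (fun k => normc (inner (S k x) y - inner (T x) y)) @ \oo --> (0 : R)) ->
  \forall k \near \oo, U (S k).
Proof.
move=> [V oV <-] VT ST.
have : {ptws, (fun k => wot_eval (S k)) @ \oo --> (wot_eval T : H * H -> R[i]^o)}.
  apply/pointwise_cvgP => -[x y].
  apply/cvgrPdist_lt => eps eps0.
  have er : eps = (complex.Re eps)%:C%C by rewrite RRe_real// gtr0_real.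
  have /cvgr0Pnorm_lt/(_ (complex.Re eps)) := ST x y.
  rewrite -ltcR -er => /(_ eps0)[N _ NP]; exists N => // k Nk /=.
  rewrite distrC normcE_norm er ltcR (le_lt_trans _ (NP k Nk))//.
  exact: ler_norm.
by apply; apply: open_nbhs_nbhs; split.
Qed.

(** The factor [c] makes one statement serve both the real part (c = 1) and the imaginary part (c =
    -i). *)
Lemma wot_innerRe_open (x y : H) (c : R[i]) (O : set R) : open O ->
  open [set T : wot H | O (complex.Re (c * inner ((T : bop H) x) y))].
Proof.
move=> oO.
exists [set f : prod_topology (fun _ : H * H => R[i]^o) | O (complex.Re (c * f (x, y)))] => //.
have -> : [set f : prod_topology (fun _ : H * H => R[i]^o) | O (complex.Re (c * f (x, y)))] =
  (fun f => f (x, y)) @^-1` [set a : R[i]^o | O (complex.Re (c * a))] by [].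
apply: open_comp => [f _|]; first exact: (@proj_continuous _ (fun _ : H * H => R[i]^o)).
rewrite openE => a /= Oa.
have /nbhs_normP[eps /= eps0 epsO] := open_nbhs_nbhs (conj oO Oa).
have c0 : 0 < normc c + 1 by rewrite ltr_wpDl ?normc_ge0.
apply/nbhs_ballP; exists (eps / (normc c + 1))%:C%C.
  by rewrite /= ltcR divr_gt0.
move=> b; rewrite -ball_normE /= normcE_norm ltcR ltr_pdivlMr// => ab.
apply: epsO => /=; rewrite -raddfB -mulrBr (le_lt_trans (Re_le_normc _))// normcM.
by apply: le_lt_trans ab; rewrite mulrC ler_wpM2l ?normc_ge0// lerDl.
Qed.

End WeakOperatorTopology.

Section WeakMeasurable.
Context (dd : measure_display) (W : measurableType dd) (R : realType).
Variable H : hilbertType R.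

Definition wmeas (K : hilbertType R) (F : W -> bop K) : Prop :=
  forall x y, cmeas (fun w => inner (F w x) y).

(** Coefficients of tensor operators are computed on basis tensors only; linearity and pointwise
    limits reach all vectors, first in [x] and then in [y]. *)
Lemma wmeas_basis (K : hilbertType R) (E : nat -> K) (F : W -> bop K) : hilbert_basis E ->
  (forall i j, cmeas (fun w => inner (F w (E i)) (E j))) -> wmeas F.
Proof.
move=> Eb FE x y; move: x; apply: (basis_ind Eb) => [|a x x' hx hx'|u l hu ul|i].
- have -> : (fun w => inner (F w 0) y) = fun=> 0.
    by apply/funext => w; rewrite (lin0 (bop_linear (F w))) inner0l.
  exact: cmeas_cst.
- have -> : (fun w => inner (F w (a *: x + x')) y) =
    fun w => a * inner (F w x) y + inner (F w x') y.
    by apply/funext => w; rewrite (bop_linear (F w)) inner_linear.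
  by apply: cmeasD => //; apply: cmeasM => //; exact: cmeas_cst.
- apply: cmeas_lim hu _ => w; apply: hlim_inner.
  exact: (lbnd_hlim (bop_lbnd (F w)) ul).
move: y; apply: (basis_ind Eb) => [|a x x' hx hx'|u l hu ul|j //].
- have -> : (fun w => inner (F w (E i)) 0) = fun=> 0.
    by apply/funext => w; rewrite inner0r.
  exact: cmeas_cst.
- have -> : (fun w => inner (F w (E i)) (a *: x + x')) =
    fun w => conjc a * inner (F w (E i)) x + inner (F w (E i)) x'.
    by apply/funext => w; rewrite innerDr innerZr.
  by apply: cmeasD => //; apply: cmeasM => //; exact: cmeas_cst.
- apply: cmeas_lim hu _ => w.
  rewrite (_ : (fun n => _) = fun n => normc (inner (u n) (F w (E i)) -
    inner l (F w (E i)))); first exact: hlim_inner.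
  apply/funext => n; rewrite innerC [inner (F w _) l]innerC -raddfB.
  exact: normcJ_eq.
Qed.

Variable e : nat -> H.
Hypothesis eb : hilbert_basis e.

Lemma wmeas_cst (T : bop H) : wmeas (fun=> T).
Proof. by move=> x y; exact: cmeas_cst. Qed.

(** Expanding [G w x] along the basis gives <F G x, y> as the sum of <G x, e_i> <F e_i, y>, a
    pointwise limit of measurable functions although composition is not jointly weakly
    continuous. *)
Lemma wmeas_comp (F G : W -> bop H) : wmeas F -> wmeas G ->
  wmeas (fun w => bop_comp (F w) (G w)).
Proof.
move=> mF mG x y; pose h n w := \sum_(0 <= i < n) inner (G w x) (e i) * inner (F w (e i)) y.
apply: (@cmeas_lim _ _ _ h) => [n|w].
  by apply: cmeas_sum => i; apply: cmeasM; [exact: mG|exact: mF].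
have := hlim_inner y (lbnd_hlim (bop_lbnd (F w)) (fourier_expansion (G w x) eb)).
rewrite [X in X @ _ --> _ -> _](_ : _ = fun n => normc (h n w - inner (F w (G w x)) y))//.
apply/funext => n; rewrite /h /=.
rewrite (lin_sum (bop_linear (F w))) inner_suml; congr (normc (_ - _)).
by apply: eq_bigr => i _; rewrite (linZ (bop_linear (F w))) innerZl.
Qed.

Lemma wmeas_adj (F : W -> bop H) : wmeas F -> wmeas (fun w => adj (F w)).
Proof.
move=> mF x y; have -> : (fun w => inner (adj (F w) x) y) = fun w => conjc (inner (F w y) x).
  by apply/funext => w; rewrite (adjP (F w) eb) -innerC.
exact: cmeasJ.
Qed.

Lemma wmeas_tensor (K : hilbertType R) (t : H -> H -> K) (F G : W -> bop H) :
  tensor_map t -> wmeas F -> wmeas G -> wmeas (fun w => tensor_op t (F w) (G w)).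
Proof.
move=> tm mF mG; have [s _ Eb] := tensor_basis tm eb.
apply: (wmeas_basis Eb) => i j; have [_ _ t3 _] := tm.
under eq_fun do rewrite (tensor_opE tm eb) t3.
by apply: cmeasM; [exact: mF|exact: mG].
Qed.

Lemma wmeas_conjugate (K : hilbertType R) (U : K -> H) (V : H -> K) (F : W -> bop K) :
  lbnd U 1 -> lbnd V 1 -> (forall z x, inner (U z) x = inner z (V x)) ->
  wmeas F -> wmeas (fun w => conjugate U V (F w)).
Proof.
move=> U1 V1 UV mF x y.
by under eq_fun do rewrite conjugateE// UV; exact: mF.
Qed.

Lemma le_add_small (a b c : R) : 0 <= c ->
  (forall eps, 0 < eps -> a <= b + c * eps) -> a <= b.
Proof.
move=> c0 h; apply/ler_addgt0Pr => eps eps0.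
have c1 : 0 < c + 1 by rewrite ltr_wpDl.
have /h/le_trans : 0 < eps / (c + 1) by rewrite divr_gt0.
apply; rewrite lerD2l mulrA ler_pdivrMr// mulrC ler_wpM2l ?lerDl//; exact: ltW.
Qed.

Variable d : nat -> H.
Hypothesis dd_dense : dense_seq d.

(** The operator-norm ball of radius [n], tested on the dense sequence alone so that it is cut out
    by countably many conditions. *)
Definition norm_ball (n : nat) : set (bop H) :=
  [set T | forall i j, normc (inner (T (d i)) (d j)) <= n%:R * rnorm (d i) * rnorm (d j)].

(** Density is used twice: duality first frees the second vector ([hd]), then boundedness of [T]
    frees the first. *)
Lemma norm_ballP n T : norm_ball n T -> forall x, rnorm (T x) <= n%:R * rnorm x.
Proof.
move=> nT.
have hd i : rnorm (T (d i)) <= n%:R * rnorm (d i).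
  apply: rnorm_dual => [|y]; first by rewrite mulr_ge0 ?rnorm_ge0.
  apply: (@le_add_small _ _ (rnorm (T (d i)) + n%:R * rnorm (d i))) => [|eps eps0].
    by rewrite addr_ge0 ?mulr_ge0 ?rnorm_ge0.
  have [j yj] := dd_dense y eps0.
  rewrite -[y in inner _ y](subrK (d j)) innerDr (le_trans (le_normcD _ _))//.
  rewrite mulrDl addrCA lerD//.
    by rewrite (le_trans (CauchySchwarz_inner _ _))// ler_wpM2l ?rnorm_ge0// ltW.
  rewrite (le_trans (nT i j))// -mulrDr ler_wpM2l ?mulr_ge0 ?rnorm_ge0//.
  rewrite -[d j](subrK y) addrC (le_trans (rnormD _ _))// lerD2l rnormB ltW//.
move=> x; apply: (@le_add_small _ _ (opnorm T + n%:R)) => [|eps eps0].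
  by rewrite addr_ge0 ?opnorm_ge0.
have [i xi] := dd_dense x eps0.
rewrite -[x in T x](subrK (d i)) (linD (bop_linear T)) (le_trans (rnormD _ _))//.
rewrite mulrDl addrCA lerD//.
  by rewrite (le_trans (opnormP _ _))// ler_wpM2l ?opnorm_ge0// ltW.
rewrite (le_trans (hd i))// -mulrDr ler_wpM2l//.
by rewrite -[d i](subrK x) addrC (le_trans (rnormD _ _))// lerD2l rnormB ltW.
Qed.

Lemma norm_ball_cover T : exists n, norm_ball n T.
Proof.
exists (Num.truncn (opnorm T)).+1 => i j.
rewrite (le_trans (CauchySchwarz_inner _ _))// ler_wpM2r ?rnorm_ge0//.
rewrite (le_trans (opnormP _ _))// ler_wpM2r ?rnorm_ge0// ltW//.
by have /andP[] := truncn_itv (opnorm_ge0 T).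
Qed.

Definition wot_coord (p : nat) (T : bop H) : R :=
  if unpickle p is Some (i, j, b) then
    if b then complex.Re (inner (T (d i)) (d j)) else complex.Im (inner (T (d i)) (d j))
  else 0.

Lemma normc_le_ReIm (a : R[i]) : normc a <= `|complex.Re a| + `|complex.Im a|.
Proof.
rewrite -[normc a]ger0_norm ?normc_ge0// -ler_sqr ?nnegrE ?addr_ge0//.
case: a => a b /=; rewrite ger0_norm ?sqrtr_ge0// sqr_sqrtr ?addr_ge0 ?sqr_ge0//.
rewrite sqrrD !real_normK ?num_real// lerD2r lerDl.
by rewrite mulrn_wge0// mulr_ge0.
Qed.

(** Otherwise some [S k] in the ball would agree with [T] ever better on ever more coordinates and
    yet avoid [U]. The uniform norm bound extends this convergence from the dense sequence to all
    vectors, so [S k] tends to [T] weakly, which contradicts openness of [U]. *)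
Lemma wot_ball_cell n (U : set (wot H)) (T : bop H) : open U -> U T -> norm_ball n T ->
  exists k, forall S, norm_ball n S ->
    (forall p, (p < k)%N -> `|wot_coord p S - wot_coord p T| < k.+1%:R^-1) -> U S.
Proof.
move=> oU UT nT; apply: contrapT => /forallNP hk.
have /choice[S SP] k : exists S, [/\ norm_ball n S,
    forall p, (p < k)%N -> `|wot_coord p S - wot_coord p T| < k.+1%:R^-1 & ~ U S].
  have /existsNP[S /not_implyP[nS /not_implyP[cS US]]] := hk k.
  by exists S.
suff /(wot_seq oU UT)[N _ NU] : forall x y,
    (fun k => normc (inner (S k x) y - inner (T x) y)) @ \oo --> (0 : R).
  by have [_ _] := SP N; apply; apply: NU => /=.
move=> x y; apply/cvgr0Pnorm_lt => eps eps0.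
(* Both [S k] and [T] lie in the ball of radius [n], so 2n bounds their difference uniformly in
   [k]. *)
pose C : R := n%:R + n%:R.
have C0 : 0 <= C by rewrite addr_ge0.
have dS k z : rnorm (S k z - T z) <= C * rnorm z.
  have [nS _ _] := SP k.
  by rewrite (le_trans (rnormD _ _))// rnormN mulrDl lerD// norm_ballP.
have e3 : 0 < eps / 4 by rewrite divr_gt0.
have y0 : 0 < C * rnorm y + 1 by rewrite ltr_wpDl// mulr_ge0 ?rnorm_ge0.
(* The four quarters of [eps] pay for replacing [x] by [d i], for replacing [y] by [d j], and for
   the real and the imaginary part of the remaining coefficient. The accuracy for [y] depends on |d
   i|, so [i] comes first. *)
have [|i xi] := dd_dense x (e := eps / 4 / (C * rnorm y + 1)); first by rewrite divr_gt0.
have x0 : 0 < C * rnorm (d i) + 1 by rewrite ltr_wpDl// mulr_ge0 ?rnorm_ge0.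
have [|j yj] := dd_dense y (e := eps / 4 / (C * rnorm (d i) + 1)); first by rewrite divr_gt0.
pose p (b : bool) := pickle (i, j, b).
near=> k.
have [_ ck _] := SP k.
have pt : (p true < k)%N by near: k; exists (p true).+1.
have pf : (p false < k)%N by near: k; exists (p false).+1.
have hc b : `|wot_coord (p b) (S k) - wot_coord (p b) T| < eps / 4.
  apply: (@lt_trans _ _ k.+1%:R^-1).
    by apply: ck; case: b.
  by near: k; exact: near_infty_natSinv_lt (PosNum e3).
rewrite ger0_norm ?normc_ge0// -innerBl.
set A := fun z => S k z - T z.
have Alin : linear A.
  move=> a z z'; rewrite /A (bop_linear (S k)) (bop_linear T).
  by rewrite opprD addrACA scalerBr.
rewrite -[S k x - T x]/(A x).
have -> : inner (A x) y = inner (A (x - d i)) y + inner (A (d i)) (y - d j)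
    + inner (A (d i)) (d j).
  by rewrite (linB Alin) innerBl innerBr; ring.
rewrite (le_lt_trans (le_normcD _ _))//.
have -> : eps = (eps / 4 + eps / 4) + (eps / 4 + eps / 4) by field.
apply: ltrD.
  rewrite (le_lt_trans (le_normcD _ _))// ltrD//.
    rewrite (le_lt_trans (CauchySchwarz_inner _ _))//.
    rewrite (le_lt_trans (ler_wpM2r (rnorm_ge0 y) (dS k (x - d i))))//.
    rewrite ltr_pdivlMr// in xi; apply: le_lt_trans xi.
    by rewrite -mulrA mulrCA ler_wpM2l ?rnorm_ge0// lerDl.
  rewrite (le_lt_trans (CauchySchwarz_inner _ _))//.
  rewrite (le_lt_trans (ler_wpM2r (rnorm_ge0 _) (dS k (d i))))//.
  rewrite ltr_pdivlMr// in yj; apply: le_lt_trans yj.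
  by rewrite mulrC ler_wpM2l ?rnorm_ge0// lerDl.
rewrite (le_lt_trans (normc_le_ReIm _))// /A innerBl !raddfB ltrD//.
  by have := hc true; rewrite /p /wot_coord pickleK.
by have := hc false; rewrite /p /wot_coord pickleK.
Unshelve. all: by end_near. Qed.

(** Open sets generate the Borel structure. Each is cut along the countably many norm balls, because
    the cell argument requires a uniform norm bound. *)
Lemma wmeas_measurable (F : W -> bop H) : wmeas F ->
  measurable_fun setT (F : W -> borel_bop H).
Proof.
move=> mF; apply: (@measurability _ _ _ (borel_bop H) setT F (@open (wot H))) => //.
move=> _ [U oU <-]; rewrite setTI.
have -> : F @^-1` U = \bigcup_n F @^-1` (U `&` norm_ball n).
  apply/seteqP; split=> [w Uw|w [n _ []]//].
  by have [n nF] := norm_ball_cover (F w); exists n.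
apply: bigcupT_measurable => n; apply: (@cell_measurable _ _ _ _ F wot_coord).
- move=> p; rewrite /wot_coord; case: unpickle => [[[i j] b]|]; last exact: measurable_cst.
  by have [m1 m2] := mF (d i) (d j); case: b.
- have -> : F @^-1` norm_ball n = \bigcap_i \bigcap_j
      [set w | normc (inner (F w (d i)) (d j)) <= n%:R * rnorm (d i) * rnorm (d j)].
    by apply/seteqP; split=> w h i => [_ j _|j]; [exact: h|exact: (h i I j I)].
  apply: bigcapT_measurable => i; apply: bigcapT_measurable => j.
  by apply: cmeas_normc_le => //; rewrite !mulr_ge0 ?rnorm_ge0.
- by move=> T UT nT; exact: wot_ball_cell.
Qed.

Lemma measurable_wmeas (F : W -> bop H) :
  measurable_fun setT (F : W -> borel_bop H) -> wmeas F.
Proof.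
move=> mF x y.
have h (c : R[i]) : measurable_fun setT (fun w => complex.Re (c * inner (F w x) y)).
  apply: (measurability _ (RGenOpens.measurableE R)) => _ [_ [a [b ->]] <-].
  rewrite setTI.
  have -> : (fun w => complex.Re (c * inner (F w x) y)) @^-1` `]a, b[%classic =
      F @^-1` [set T | `]a, b[%classic (complex.Re (c * inner (T x) y))] by [].
  rewrite -[X in measurable X]setTI; apply: mF => //.
  apply: sub_sigma_algebra; apply: wot_innerRe_open; exact: interval_open.
split; first by have := h 1; under eq_fun do rewrite mul1r.
(* The real part of -i a is the imaginary part of a. *)
have := h (- 'i%C); congr (measurable_fun _ _); apply/funext => w.
by rewrite mulNr mulrC raddfN/= ReiNIm opprK.
Qed.

End WeakMeasurable.

(** * The maps Tensor and Tensor0 *)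

Section ProductBorelStructure.
Variables (R : realType) (H : hilbertType R).

Lemma measurable_Gamma (dd : measure_display) (W : measurableType dd) (F : W -> Gamma H) :
  (forall n, measurable_fun setT ((fun w => F w n) : W -> borel_bop H)) ->
  measurable_fun setT F.
Proof.
move=> mF; apply: (@measurability _ _ _ (Gamma H) setT F (@Gamma_cylinders R H)) => //.
move=> _ [_ [n [B [mB ->]]] <-].
exact: mF.
Qed.

Lemma measurable_coord n :
  measurable_fun setT ((fun g : Gamma H => g n) : Gamma H -> borel_bop H).
Proof. by move=> _ B mB; rewrite setTI; apply: sub_sigma_algebra; exists n, B. Qed.

Lemma wmeas_letter (dd : measure_display) (W : measurableType dd) (e : nat -> H)
    (F : W -> Gamma H) p : hilbert_basis e ->
  measurable_fun setT F -> wmeas (fun w => letter (F w) p).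
Proof.
move=> eb mF; have mn : wmeas (fun w => F w p.1).
  apply: measurable_wmeas; exact: (measurableT_comp (measurable_coord p.1) mF).
by rewrite /letter; case: p.2 => //; exact: (wmeas_adj eb).
Qed.

Lemma wmeas_word (dd : measure_display) (W : measurableType dd) (e : nat -> H)
    (F : W -> Gamma H) s : hilbert_basis e ->
  measurable_fun setT F -> wmeas (fun w => word (F w) s).
Proof.
move=> eb mF; elim: s => [|p s IH] /=; first exact: wmeas_cst.
by apply: (wmeas_comp eb) => //; exact: (wmeas_letter _ eb).
Qed.

End ProductBorelStructure.

Theorem lemma3p10 (R : realType) (H : hilbertType R)
    (Hsep : separable H) (Hinf : infinite_dimensional H)
    (HH : hilbertType R) (t : {bilinear H -> H -> HH})
    (Ht : hilbert_tensor t) :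
  exists2 Tensor : Gamma H * Gamma H -> Gamma H,
    measurable_fun setT Tensor /\
    (forall g d : Gamma H,
       star_isomorphic (min_tensor t (Cstar g) (Cstar d))
                       (Cstar (Tensor (g, d)))) &
    exists2 Tensor0 : Gamma H * Gamma H -> Gamma H,
      measurable_fun setT Tensor0 &
      forall g d : Gamma H, Cstar d (bop_id H) ->
        exists2 f : bop HH -> bop H,
          star_isomorphism (min_tensor t (Cstar g) (Cstar d))
                           (Cstar (Tensor (g, d))) f &
          f @` tensor_one t (Cstar g) = Cstar (Tensor0 (g, d)).
Proof.
have [e eb] := separable_basis Hsep Hinf.
have [d dd] := separable_seq Hsep.
have tm := hilbert_tensor_map Ht; have [s _ Eb] := tensor_basis tm eb.
have [U [V [U1 V1 UK VK UV]]] := basis_unitary Eb eb.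
have cs := conjugate_star U1 V1 UK UV.
have cK := conjugateK U1 V1 UK.
have cK' := conjugateK V1 U1 VK.
have Vs : star_contraction (conjugate V U).
  apply: conjugate_star => // x z.
  by rewrite innerC -UV -innerC.
(* Conjugation in the opposite direction, contractive by [Vs], is the left inverse that
   [Cstar_image] asks for. *)
have cimg (g : Gamma HH) : conjugate U V @` Cstar g =
    Cstar ((conjugate U V \o g) : Gamma H).
  apply: (Cstar_image cs Eb cK) => [S T|T]; first exact: conjugateB.
  by have [_ _ _] := Vs.
pose Tensor (p : Gamma H * Gamma H) : Gamma H :=
  conjugate U V \o tensor_gens t p.1 p.2.
pose Tensor0 (p : Gamma H * Gamma H) : Gamma H :=
  conjugate U V \o (amplify t \o p.1).
have iso g d' : star_isomorphism (min_tensor t (Cstar g) (Cstar d'))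
    (Cstar (Tensor (g, d'))) (conjugate U V).
  have [l M a _] := cs; split=> [|c S T _ _|S T _ _|S T _ _].
  - rewrite (min_tensor_gens Ht eb) /Tensor -cimg; split.
    + by move=> S gS; exists S.
    + by move=> S T _ _; exact: (can_inj cK).
    + by move=> _ [S gS <-]; exists S.
  - exact: l.
  - exact: M.
  - exact: a.
exists Tensor.
  split; last by move=> g d'; exists (conjugate U V); exact: iso.
  apply: measurable_Gamma => n; apply: (wmeas_measurable dd).
  apply: (wmeas_conjugate U1 V1 UV); rewrite /tensor_gens.
  (* The pair of words depends on [n] alone, so each coordinate of [Tensor] is one fixed operation
     on the two sequences. *)
  case: unpickle => [[w w']|]; last exact: wmeas_cst.
  case: (_ && _); last exact: wmeas_cst.
  apply: (wmeas_tensor eb tm); apply: (wmeas_word _ eb).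
    exact: measurable_fst.
  exact: measurable_snd.
exists Tensor0.
  apply: measurable_Gamma => n; apply: (wmeas_measurable dd).
  apply: (wmeas_conjugate U1 V1 UV); apply: (wmeas_tensor eb tm); last exact: wmeas_cst.
  apply: measurable_wmeas; apply: (measurableT_comp (measurable_coord n)).
  exact: measurable_fst.
(* The conjugation that gives the isomorphism also carries the generators [amplify t (g n)] to the
   terms of [Tensor0]. *)
move=> g d' _; exists (conjugate U V); first exact: iso.
by rewrite (tensor_one_amplify Ht eb) cimg.
Qed.
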